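(* Let $n,d\ge 1$ be integers and $\alpha\in[0,1]$. Let $\widehat{C}_n$ be any algorithm that provides a $(1-\alpha)$-distribution-free confidence interval for binary regression. Then for any nonatomic distribution $P$ on $\mathbb{R}^d\times\{0,1\}$, with $(X_1,Y_1),\dots,(X_{n+1},Y_{n+1})$ drawn i.i.d. from $P$, \[\mathbb{E}\left[\mathrm{leb}(\widehat{C}_n(X_{n+1}))\right]\ge L_\alpha(\Pi_P),\] where $\Pi_P$ is the distribution of the random variable $\pi_P(X)\in[0,1]$ with $(X,Y)\sim P$.
   Context: For a distribution $P$ on $(X,Y)\in\mathbb{R}^d\times\{0,1\}$, let $\pi_P(x)=\mathbb{P}_P\{Y=1\mid X=x\}$. $\mathrm{leb}$ denotes Lebesgue measure on $\mathbb{R}$. An algorithm $\widehat{C}_n$ takes the training data $(X_1,Y_1),\dots,(X_n,Y_n)\in\mathbb{R}^d\times\{0,1\}$ and produces a map sending each $x\in\mathbb{R}^d$ to a set $\widehat{C}_n(x)\subseteq\mathbb{R}$ (suitable measurability is implicit). The algorithm may be randomized: $\widehat{C}_n(x)$ may also depend on additional randomness independent of the data, and then all probabilities and expectations are also taken over this randomness. The set $\widehat{C}_n(X_{n+1})$ is computed from $(X_i,Y_i)_{i\le n}$ and $X_{n+1}$ (not $Y_{n+1}$). $\widehat{C}_n$ provides a $(1-\alpha)$-distribution-free confidence interval for binary regression if, for all distributions $P$ on $\mathbb{R}^d\times\{0,1\}$, with $(X_i,Y_i)$, $i=1,\dots,n+1$, drawn i.i.d. from $P$, \[\mathbb{P}\{\pi_P(X_{n+1})\in\widehat{C}_n(X_{n+1})\}\ge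 1-\alpha.\] $P$ is nonatomic if it assigns zero probability to every single point. The function $\ell:[0,1]\times[0,1]\to[0,1]$ is defined for $t\in[0,\frac12]$, $a\in[0,1]$ by \[\ell(t,a)=\begin{cases}2(1-a)t,& a\ge\frac12,\\ \frac{t}{2a},& a\ge t\text{ and }0<a<\frac12,\\ 1-\frac{a}{2t},& a<t,\\ 0,& a=t=0,\end{cases}\] and for $t\in(\frac12,1]$ by $\ell(t,a)=\ell(1-t,a)$. For any distribution $Q$ on $[0,1]$ and $\alpha\in[0,1]$, \[L_\alpha(Q)=\inf\Big\{\mathbb{E}_{T\sim Q}[\ell(T,a(T))] \ :\ a:[0,1]\to[0,1]\text{ measurable},\ \mathbb{E}_{T\sim Q}[a(T)]\le\alpha\Big\}.\] *)

(* Defs.v *)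
(* MathComp-Analysis, over an arbitrary [R : realType]. *)
From HB Require Import structures.
From mathcomp Require Import all_boot all_order all_algebra.
From mathcomp Require Import all_classical all_reals all_analysis.

Set Implicit Arguments.
Unset Strict Implicit.
Unset Printing Implicit Defensive.

Import Order.TTheory GRing.Theory Num.Theory.
Import numFieldNormedType.Exports.

Local Open Scope classical_set_scope.
Local Open Scope ring_scope.
Local Open Scope ereal_scope.

(* R^d is [d.-tuple R] with the sigma-algebra generated by the coordinates (the
   Borel sigma-algebra); the label Y = 1 is [true]. *)
Notation example R d := (d.-tuple R * bool)%type.

Section product_law.
Context d (T : measurableType d) (R : realType).

Definition tuple_cons (n : nat) (z : T * n.-tuple T) : n.+1.-tuple T :=
  [the n.+1.-tuple T of z.1 :: z.2].

Lemma measurable_tuple_cons (n : nat) :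
  measurable_fun [set: T * n.-tuple T] (@tuple_cons n).
Proof. by apply: measurable_cons; [exact: measurable_fst|exact: measurable_snd]. Qed.

HB.instance Definition _ (n : nat) :=
  isMeasurableFun.Build _ _ _ _ (@tuple_cons n) (@measurable_tuple_cons n).

(* The law P^n of n i.i.d. draws from P. *)
Fixpoint iid_law (P : probability T R) (n : nat) : probability (n.-tuple T) R :=
  match n return probability (n.-tuple T) R with
  | 0 => dirac [tuple of [::]]
  | m.+1 => distribution (P \x iid_law P m) (@tuple_cons m)
  end.

Lemma iid_law_rectangle (P : probability T R) (n : nat) (A : 'I_n -> set T) :
  (forall i, measurable (A i)) ->
  iid_law P n [set z | forall i, A i (tnth z i)] = \prod_(i < n) P (A i).
Proof.
elim: n A => [|n IHn] A mA.
  rewrite big_ord0 /= diracE mem_set//.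
  by move=> [].
rewrite big_ord_recl -IHn; last by move=> i; exact: mA.
rewrite /= /distribution /pushforward.
have mB : measurable
    [set z : n.-tuple T | forall i, A (lift ord0 i) (tnth z i)].
  have -> : [set z : n.-tuple T | forall i, A (lift ord0 i) (tnth z i)] =
      \bigcap_(i in [set: 'I_n]) ((@tnth n T)^~ i @^-1` A (lift ord0 i)).
    apply/seteqP; split=> z /= h i; [by move=> _; exact: h|exact: (h i I)].
  apply: fin_bigcap_measurable => // i _.
  by rewrite -[X in measurable X]setTI; exact: (measurable_tnth i).
rewrite -product_measure1E//; congr (_ _); apply/seteqP; split=> [[x z]|[x z]] /=.
  move=> h; split; first by have := h ord0; rewrite tnth0.
  by move=> i; have := h (lift ord0 i); rewrite tnthS.
move=> [/= Ax Az] i; case: (unliftP ord0 i) => [j ->|->]; last by rewrite tnth0.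
by rewrite tnthS.
Qed.

End product_law.

Section binary_regression.
Context (R : realType) (d : nat).
Implicit Types (P : probability (example R d) R).

Definition nonatomic P : Prop := forall z : example R d, P [set z] = 0.

(* [eta] is a version of x |-> P{Y = 1 | X = x}.  Such a version always exists
   and is unique up to a null set of the law of X. *)
Definition is_regression_function P (eta : {mfun d.-tuple R >-> R}) : Prop :=
  (forall x, (0 <= eta x <= 1)%R) /\
  (forall A : set (d.-tuple R), measurable A ->
     \int[P]_(z in fst @^-1` A) (eta z.1)%:E = P (A `*` [set true])).

Lemma measurable_feature (eta : {mfun d.-tuple R >-> R}) :
  measurable_fun [set: example R d] (fun z => eta z.1).
Proof. by apply: measurableT_comp => //; exact: measurable_fst. Qed.

Definition feature_fun (eta : {mfun d.-tuple R >-> R}) (z : example R d) : R :=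
  eta z.1.

HB.instance Definition _ (eta : {mfun d.-tuple R >-> R}) :=
  isMeasurableFun.Build _ _ _ _ (feature_fun eta) (measurable_feature eta).

(* The distribution of eta(X), (X, Y) ~ P. *)
Definition regression_law P (eta : {mfun d.-tuple R >-> R}) : probability R R :=
  distribution P (feature_fun eta).

Section algorithm.
Context (n : nat) (dXi : measure_display) (Xi : measurableType dXi).

(* A (randomized) procedure maps the training data, a random seed in Xi and a
   test point to a set; a deterministic one has a trivial seed. *)
Definition algorithm : Type :=
  n.-tuple (example R d) -> Xi -> d.-tuple R -> set R.

Definition measurable_algorithm (C : algorithm) : Prop :=
  measurable [set w : (n.-tuple (example R d) * Xi) * d.-tuple R * R |
    C w.1.1.1 w.1.1.2 w.1.2 w.2].

(* Joint law of the training data, the independent seed and the test example,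
   i.e. P^n x nu x P: the n training examples and the test example are i.i.d.
   from P and independent of the seed. *)
Definition experiment (nu : probability Xi R) P :
    probability ((n.-tuple (example R d) * Xi) * example R d)%type R :=
  (iid_law P n \x nu) \x P.

Definition distribution_free_CI (nu : probability Xi R) (alpha : R)
    (C : algorithm) : Prop :=
  forall P (eta : {mfun d.-tuple R >-> R}), is_regression_function P eta ->
    (1 - alpha)%:E <=
      experiment nu P [set w | C w.1.1 w.1.2 w.2.1 (eta w.2.1)].

Definition expected_length (nu : probability Xi R) P (C : algorithm) : \bar R :=
  \int[experiment nu P]_w lebesgue_measure (C w.1.1 w.1.2 w.2.1).

End algorithm.
End binary_regression.

Section lower_bound.
Context (R : realType).

(* [ell t a] for t <= 1/2. *)
Definition ell_half (t a : R) : R :=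
  (if 1 / 2 <= a then 2 * (1 - a) * t
   else if (t <= a) && (0 < a) then t / (2 * a)
   else if a < t then 1 - a / (2 * t)
   else 0)%R.

Definition ell (t a : R) : R :=
  (if t <= 1 / 2 then ell_half t a else ell_half (1 - t) a)%R.

Definition unit_interval : set R := `[0%R, 1%R]%classic.

(* A distribution Q on [0, 1] is a probability measure on R carried by
   [0, 1], and a function on [0, 1] is a function on R considered on [0, 1]. *)
Definition L (alpha : R) (Q : probability R R) : \bar R :=
  ereal_inf [set \int[Q]_(t in unit_interval) (ell t (a t))%:E | a in
    [set a : R -> R |
      [/\ measurable_fun unit_interval a,
          (forall t, unit_interval t -> unit_interval (a t)) &
          \int[Q]_(t in unit_interval) (a t)%:E <= alpha%:E]]].

End lower_bound.

(* Main.v *)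
Require Import Defs.
From HB Require Import structures.
From mathcomp Require Import all_boot all_order all_algebra.
From mathcomp Require Import all_classical all_reals all_analysis.
From mathcomp Require Import measurable_realfun ring lra.

(** Why the bound holds.  A confidence interval for the regression function has
    to survive the following disguise.  Cut R^d into finitely many cells that P
    hardly ever hits twice, give every cell an independent uniform mark u, and
    replace eta by x |-> F (eta x, u), u the mark of the cell of x, where F (t, u)
    has mean t when u is uniform on [0, 1].  For each choice of the marks this is
    a distribution like any other, with the feature law of P and with a new
    regression function, so C must cover the new function.  But as long as the
    n + 1 features lie in different cells the labels have the same joint law as
    under P, whatever F is.  Since P is nonatomic the collision probability can
    be made arbitrarily small, hence C computed from a sample of P covers the
    randomized value F (eta X, u) with probability at least 1 - alpha
    ([coverage_randomized_value]; the combinatorial core is [decouple]).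

    For a multiplier l > 0, choose F so that F (t, u) has density 1/l on a
    subinterval of [0, 1] of length w and otherwise sits at one point p, under
    the constraint that its mean is t.  If c z is the probability that C x
    contains z, a change of variables in the uniform part gives
      l * E (c (F (t, u))) + w <= (integral of c over [0, 1]) + l,
    because what is lost at the atom is at most its mass (l - w) / l
    ([sampler_trade_off]).  With w = [width l t], the largest length compatible
    with mean t, integrating over X yields, B being the expected length of C,
      E (width l (eta X)) <= B + l * alpha        ([width_bound]).

    It remains to see that these inequalities, one for each l, imply
    L alpha <= B.  This is Lagrangian duality for the infimum that defines L:
    width l t is the minimum over a of ell t a + l * a, attained at
    a = [weight l t] ([weightP]).  As ell t is convex ([ell_convex]), two nearby
    multipliers, one whose weight overshoots the budget alpha and one that
    respects it, can be mixed into a feasible function a whose cost is at most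
    B + e ([L_le_bound_pos]); for alpha = 0 the multiplier goes to infinity
    instead ([L_le_bound_zero]). *)

Set Implicit Arguments.
Unset Strict Implicit.
Unset Printing Implicit Defensive.

Import Order.TTheory GRing.Theory Num.Theory.
Import numFieldNormedType.Exports.

Local Open Scope classical_set_scope.
Local Open Scope ring_scope.
Local Open Scope ereal_scope.

(** * Laws of i.i.d. samples *)

Section iid.
Context (R : realType).

Lemma integral_law d d' (S : measurableType d) (T : measurableType d')
    (mu : {measure set S -> \bar R}) (nu : {measure set T -> \bar R})
    (phi : S -> T) (h : T -> \bar R) :
  measurable_fun setT phi ->
  (forall B, measurable B -> nu B = mu (phi @^-1` B)) ->
  measurable_fun setT h -> (forall y, 0 <= h y) ->
  \int[nu]_y h y = \int[mu]_x h (phi x).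
Proof.
move=> mphi nuE mh h0.
pose phi' : {mfun S >-> T} := HB.pack phi (isMeasurableFun.Build _ _ _ _ phi mphi).
transitivity (\int[pushforward mu phi']_y h y); last first.
  by rewrite ge0_integral_pushforward.
by apply: eq_measure_integral => /= A mA _; rewrite nuE.
Qed.

(** The products of measurable sets form the pi-system on which a law on tuples
    is tested. *)
Definition rectangle d (T : measurableType d) n (A : 'I_n -> set T) :
  set (n.-tuple T) := [set z | forall i, A i (tnth z i)].

Lemma measurable_rectangle d (T : measurableType d) n (A : 'I_n -> set T) :
  (forall i, measurable (A i)) -> measurable (rectangle A).
Proof.
move=> mA.
have -> : rectangle A = \bigcap_(i in [set: 'I_n]) ((@tnth n T)^~ i @^-1` A i).
  by apply/seteqP; split=> z /= h i; [move=> _; exact: h|exact: (h i I)].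
apply: fin_bigcap_measurable => // i _.
by rewrite -[X in measurable X]setTI; exact: (measurable_tnth i).
Qed.

(** Rectangles are stable under intersection and generate the sigma-algebra of
    tuples, so two finite measures that agree on them are equal. *)
Lemma iid_law_unique d (T : measurableType d) (P : probability T R) n
    (m : {measure set (n.-tuple T) -> \bar R}) :
  (forall A : 'I_n -> set T, (forall i, measurable (A i)) ->
    m (rectangle A) = \prod_(i < n) P (A i)) ->
  forall B, measurable B -> iid_law P n B = m B.
Proof.
move=> mE B mB.
pose G := [set rectangle A | A in [set A : 'I_n -> set T | forall i, measurable (A i)]].
apply: (measure_unique G (fun=> setT)) => //.
- rewrite eqEsubset; split.
    apply: smallest_sub; first exact: smallest_sigma_algebra.
    rewrite -bigcup_seq => C [/= i _ [D mD <-]].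
    apply: sub_sigma_algebra.
    exists (fun j => if j == i then D else setT).
      by move=> j; case: ifP.
    apply/seteqP; split => z /=; first by move/(_ i); rewrite eqxx.
    by move=> [_ Dz] j; case: eqP => // ->.
  apply: smallest_sub; first exact: sigma_algebra_measurable.
  by move=> _ [A mA <-]; exact: measurable_rectangle.
- move=> _ _ [A mA <-] [D mD <-]; exists (fun i => A i `&` D i).
    by move=> i; exact: measurableI.
  apply/seteqP; split => z /=; first by move=> h; split => i; case: (h i).
  by move=> [h1 h2] i; split; [exact: h1|exact: h2].
- by move=> _; exists (fun=> setT) => //; apply/seteqP; split.
- by rewrite -subTset => z _; exists 0%N.
- by move=> _ [A mA <-]; rewrite mE //; exact: iid_law_rectangle.
- by move=> _ /=; rewrite probability_setT ltry.
Qed.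

Lemma measurable_mktuple d d' (S : measurableType d) (T : measurableType d') n
    (f : 'I_n -> S -> T) :
  (forall i, measurable_fun setT (f i)) ->
  measurable_fun setT (fun s => [tuple f i s | i < n]).
Proof.
move=> mf; apply/measurable_fun_tnthP => i.
by rewrite (_ : _ \o _ = f i)//; apply/funext => s /=; rewrite tnth_mktuple.
Qed.

(** Mapping every draw by [phi] gives i.i.d. draws from the image law, because
    the preimage of a rectangle is a rectangle. *)
Lemma integral_iid_map d d' (S : measurableType d) (T : measurableType d')
    (Q : probability S R) (P : probability T R) (phi : S -> T) n
    (h : n.-tuple T -> \bar R) :
  measurable_fun setT phi ->
  (forall B, measurable B -> P B = Q (phi @^-1` B)) ->
  measurable_fun setT h -> (forall y, 0 <= h y) ->
  \int[iid_law P n]_y h y =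
  \int[iid_law Q n]_x h [tuple phi (tnth x i) | i < n].
Proof.
move=> mphi PE mh h0.
have mm : measurable_fun setT
    (fun x : n.-tuple S => [tuple phi (tnth x i) | i < n]).
  apply: measurable_mktuple => i.
  by apply: measurableT_comp => //; exact: measurable_tnth.
pose m : {mfun n.-tuple S >-> n.-tuple T} :=
  HB.pack (fun x : n.-tuple S => [tuple phi (tnth x i) | i < n])
    (isMeasurableFun.Build _ _ _ _ _ mm).
apply: integral_law => // B mB.
apply: (@iid_law_unique _ _ _ _ (distribution (iid_law Q n) m)) => // A mA.
rewrite /= /distribution /pushforward.
rewrite (_ : _ @^-1` _ = rectangle (fun i => phi @^-1` A i)).
  rewrite iid_law_rectangle.
    by apply: eq_bigr => i _; rewrite PE.
  by move=> i; rewrite -[X in measurable X]setTI; exact: mphi.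
apply/seteqP; split => z /= + i => /(_ i); by rewrite tnth_mktuple.
Qed.

(** Reading distinct coordinates of an i.i.d. tuple gives an i.i.d. tuple: a
    coordinate that is not read contributes the factor 1 to the measure of a
    rectangle. Injectivity is what makes the read coordinates independent. *)
Lemma integral_iid_select d (T : measurableType d) (P : probability T R) N k
    (i : 'I_k -> 'I_N) (h : k.-tuple T -> \bar R) :
  injective i ->
  measurable_fun setT h -> (forall y, 0 <= h y) ->
  \int[iid_law P k]_y h y =
  \int[iid_law P N]_x h [tuple tnth x (i j) | j < k].
Proof.
move=> inji mh h0.
have mm : measurable_fun setT
    (fun x : N.-tuple T => [tuple tnth x (i j) | j < k]).
  by apply: measurable_mktuple => j; exact: measurable_tnth.
pose m : {mfun N.-tuple T >-> k.-tuple T} :=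
  HB.pack (fun x : N.-tuple T => [tuple tnth x (i j) | j < k])
    (isMeasurableFun.Build _ _ _ _ _ mm).
apply: integral_law => // B mB.
apply: (@iid_law_unique _ _ _ _ (distribution (iid_law P N) m)) => // A mA.
rewrite /= /distribution /pushforward.
pose A' (l : 'I_N) := if [pick j | i j == l] is Some j then A j else setT.
have A'E j : A' (i j) = A j.
  by rewrite /A'; case: pickP => [l /eqP/inji->//|/(_ j)]; rewrite eqxx.
rewrite (_ : _ @^-1` _ = rectangle A').
  rewrite iid_law_rectangle; last by move=> l; rewrite /A'; case: pickP.
  (* coordinates outside the range of i carry the factor P setT = 1 *)
  rewrite (bigID (fun l => l \in codom i))/= [X in _ * X]big1 ?mule1; last first.
    move=> l /negP li; rewrite /A'; case: pickP => [j /eqP ij|].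
      by exfalso; apply: li; rewrite -ij codom_f.
    by rewrite probability_setT.
  transitivity (\prod_(l <- codom i) P (A' l)); last first.
    by rewrite big_map big_enum/=; apply: eq_bigr => j _; rewrite A'E.
  rewrite -[LHS]big_filter; apply: perm_big; apply: uniq_perm.
  - by rewrite filter_uniq// index_enum_uniq.
  - by rewrite map_inj_uniq ?enum_uniq.
  - by move=> l; rewrite mem_filter mem_index_enum andbT.
apply/seteqP; split => z /= H l.
  by rewrite /A'; case: pickP => // j /eqP<-; have := H j; rewrite tnth_mktuple.
by have := H (i l); rewrite tnth_mktuple A'E.
Qed.

End iid.

(** * Independent marks attached to rarely shared cells *)

Section decouple.
Context (R : realType).

Lemma measurable_fun_slice d1 d2 d3 (S : measurableType d1) (T : measurableType d2)
    (Z : measurableType d3) (f : S * T -> Z) (x : S) :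
  measurable_fun setT f -> measurable_fun setT (fun y => f (x, y)).
Proof. by move=> mf; apply: measurableT_comp => //; exact: pair1_measurable. Qed.

(** Stated for probabilities, so that the inner product is a probability too and
    the two-fold theorem applies again. *)
Lemma integral_triple123 d1 d2 d3 (T1 : measurableType d1) (T2 : measurableType d2)
    (T3 : measurableType d3) (m1 : probability T1 R) (m2 : probability T2 R)
    (m3 : probability T3 R) (f : (T1 * T2) * T3 -> \bar R) :
  measurable_fun setT f -> (forall x, 0 <= f x) ->
  \int[(m1 \x m2) \x m3]_w f w =
  \int[m1]_a \int[m2]_b \int[m3]_c f ((a, b), c).
Proof.
move=> mf f0.
pose m12 : probability (T1 * T2)%type R := (m1 \x m2)%E.
rewrite -[LHS]/(\int[m12 \x m3]_w f w) fubini_tonelli1// fubini_tonelli1//.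
  exact: (measurable_fun_fubini_tonelli_F _ mf).
by move=> p; apply: integral_ge0.
Qed.

Lemma integral_triple231 d1 d2 d3 (T1 : measurableType d1) (T2 : measurableType d2)
    (T3 : measurableType d3) (m1 : probability T1 R) (m2 : probability T2 R)
    (m3 : probability T3 R) (f : (T1 * T2) * T3 -> \bar R) :
  measurable_fun setT f -> (forall x, 0 <= f x) ->
  \int[(m1 \x m2) \x m3]_w f w =
  \int[m2]_b \int[m3]_c \int[m1]_a f ((a, b), c).
Proof.
move=> mf f0.
pose m12 : probability (T1 * T2)%type R := (m1 \x m2)%E.
rewrite -[LHS]/(\int[m12 \x m3]_w f w) fubini_tonelli1// fubini_tonelli2//; last 2 first.
- exact: (measurable_fun_fubini_tonelli_F _ mf).
- by move=> p; apply: integral_ge0.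
apply: eq_integral => b _; rewrite /fubini_G/fubini_F.
rewrite (fubini_tonelli (fun p : T1 * T3 => f ((p.1, b), p.2)))//.
apply: (measurableT_comp mf (g := fun p : T1 * T3 => ((p.1, b), p.2))).
by apply: measurable_fun_pair => //; apply: measurable_fun_pair.
Qed.

Lemma integral_iid_cons d (T : measurableType d) (P : probability T R) n
    (h : n.+1.-tuple T -> \bar R) :
  measurable_fun setT h -> (forall y, 0 <= h y) ->
  \int[iid_law P n.+1]_y h y =
  \int[P]_z \int[iid_law P n]_t h [the n.+1.-tuple T of z :: t].
Proof.
move=> mh h0.
rewrite (@integral_law _ _ _ _ _ (P \x iid_law P n) _ (@tuple_cons _ T n))//.
  rewrite fubini_tonelli1//.
  by apply: measurableT_comp => //; exact: measurable_tuple_cons.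
Qed.

Definition zip_tuple (S T : Type) k (s : k.-tuple S) (t : k.-tuple T) :=
  [tuple (tnth s j, tnth t j) | j < k].

Lemma zip_tuple_cons (S T : Type) k a b (s : k.-tuple S) (t : k.-tuple T) :
  zip_tuple [the k.+1.-tuple S of a :: s] [the k.+1.-tuple T of b :: t] =
  [the k.+1.-tuple (S * T)%type of (a, b) :: zip_tuple s t].
Proof.
apply: eq_from_tnth => j; rewrite tnth_mktuple.
by case: (unliftP ord0 j) => [l ->|->]; rewrite ?tnth0// !tnthS tnth_mktuple.
Qed.

Lemma measurable_zip_tuple d d' (S : measurableType d) (T : measurableType d') k :
  measurable_fun setT (fun p : k.-tuple S * k.-tuple T => zip_tuple p.1 p.2).
Proof.
apply: measurable_mktuple => j; apply: measurable_fun_pair.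
  by apply: (measurableT_comp (@measurable_tnth _ S k j)); exact: measurable_fst.
by apply: (measurableT_comp (@measurable_tnth _ T k j)); exact: measurable_snd.
Qed.

(** Pairs of independent draws are draws from the product. A set of pairs need
    not be a product of sets, hence an induction with Fubini's theorem in place
    of the rectangle argument. *)
Lemma integral_iid_zip d d' (S : measurableType d) (T : measurableType d')
    (Q : probability S R) (U : probability T R) k
    (H : k.-tuple (S * T)%type -> \bar R) :
  measurable_fun setT H -> (forall y, 0 <= H y) ->
  \int[iid_law Q k]_s \int[iid_law U k]_u H (zip_tuple s u) =
  \int[iid_law (Q \x U)%E k]_y H y.
Proof.
elim: k H => [|k IH] H mH H0.
  have mF := measurable_fun_fubini_tonelli_F (m2 := iid_law U 0) _
    (measurableT_comp mH (@measurable_zip_tuple _ _ S T 0)) (fun p => H0 _).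
  rewrite /= integral_dirac//.
  rewrite diracT mul1e integral_dirac//.
  rewrite integral_dirac// !diracT !mul1e.
    by congr (H _); rewrite [LHS]tuple0 [RHS]tuple0.
  apply: (measurable_fun_slice (f := fun p : 0.-tuple S * 0.-tuple T =>
    H (zip_tuple p.1 p.2))).
  exact: (measurableT_comp mH (@measurable_zip_tuple _ _ S T 0)).
rewrite (integral_iid_cons _ mH)//.
rewrite (@integral_iid_cons _ _ _ _
  (fun s => \int[iid_law U k.+1]_u H (zip_tuple s u))); last 2 first.
- apply: (measurable_fun_fubini_tonelli_F (fun p => H (zip_tuple p.1 p.2))) => //.
  exact: (measurableT_comp mH (@measurable_zip_tuple _ _ _ _ _)).
- by move=> y; apply: integral_ge0.
rewrite [RHS](fubini_tonelli1 (fun z => \int[iid_law (Q \x U)%E k]_t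
  H [the k.+1.-tuple _ of z :: t])); last 2 first.
- apply: (measurable_fun_fubini_tonelli_F
    (fun p : (S * T) * k.-tuple (S * T)%type => H (tuple_cons p))) => //.
  exact: (measurableT_comp mH (@measurable_tuple_cons _ _ _)).
- by move=> y; apply: integral_ge0.
apply: eq_integral => a _; rewrite /fubini_F.
transitivity (\int[iid_law Q k]_s \int[U]_b \int[iid_law U k]_t
    H [the k.+1.-tuple _ of (a, b) :: zip_tuple s t]).
  apply: eq_integral => s _; rewrite integral_iid_cons//.
    by apply: eq_integral => b _; apply: eq_integral => t _; rewrite zip_tuple_cons.
  apply: (measurable_fun_slice (f := fun p => H (zip_tuple p.1 p.2))).
  exact: (measurableT_comp mH (@measurable_zip_tuple _ _ _ _ _)).
have mG : measurable_fun setT (fun q : (k.-tuple S * T) * k.-tuple T =>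
    H [the k.+1.-tuple _ of (a, q.1.2) :: zip_tuple q.1.1 q.2]).
  apply: (measurableT_comp mH); apply: measurable_cons.
    apply: measurable_fun_pair => //.
    by apply: (measurableT_comp (@measurable_snd _ _ _ _)); exact: measurable_fst.
  apply: (measurableT_comp (f := fun p => zip_tuple p.1 p.2) (@measurable_zip_tuple _ _ _ _ _)
    (g := fun q : (k.-tuple S * T) * k.-tuple T => (q.1.1, q.2))).
  apply: measurable_fun_pair => //.
  by apply: (measurableT_comp (@measurable_fst _ _ _ _)); exact: measurable_fst.
rewrite (fubini_tonelli (fun p => \int[iid_law U k]_t
    H [the k.+1.-tuple _ of (a, p.2) :: zip_tuple p.1 t])); last 2 first.
- exact: (measurable_fun_fubini_tonelli_F _ mG).
- by move=> p; apply: integral_ge0.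
apply: eq_integral => b _.
apply: (IH (fun y => H [the k.+1.-tuple _ of (a, b) :: y])) => //.
by apply: (measurableT_comp mH); apply: measurable_cons.
Qed.

(** Every draw is tagged with the mark of the cell [c] that contains it, so
    draws of the same cell share their mark. *)
Definition mark (S T : Type) N k (c : S -> 'I_N) (w : N.-tuple T) (s : k.-tuple S) :
  k.-tuple (S * T)%type := [tuple (tnth s j, tnth w (c (tnth s j))) | j < k].

Lemma measurable_mark d d' (S : measurableType d) (T : measurableType d') N k
    (c : S -> 'I_N) :
  (forall i, measurable (c @^-1` [set i])) ->
  measurable_fun setT (fun p : N.-tuple T * k.-tuple S => mark c p.1 p.2).
Proof.
move=> mc.
apply: measurable_mktuple => j; apply: measurable_fun_pair.
  by apply: (measurableT_comp (@measurable_tnth _ S k j)); exact: measurable_snd.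
move=> _ B mB; rewrite setTI.
rewrite (_ : _ @^-1` _ = \bigcup_(i in [set: 'I_N])
   (((fun w => tnth w i) @^-1` B) `*` ((fun s => tnth s j) @^-1` (c @^-1` [set i])))).
  apply: fin_bigcup_measurable => // i _; apply: measurableX.
    by rewrite -[X in measurable X]setTI; exact: (measurable_tnth i).
  by rewrite -[X in measurable X]setTI; exact: (measurable_tnth j).
apply/seteqP; split => [[w s]/= Bw|[w s] [i _ [/= Bw si]]].
  by exists (c (tnth s j)).
by rewrite /= si.
Qed.

(** Marks attached to cells look like fresh marks. When the k draws lie in
    distinct cells they read distinct coordinates of [w], and the marks are
    i.i.d.; the other event is contained in the union, over the pairs of
    positions and the cells i, of the events that both draws hit cell i, each of
    probability [q i ^+ 2]. *)
Lemma decouple d d' (S : measurableType d) (T : measurableType d')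
    (Q : probability S R) (U : probability T R) N (c : S -> 'I_N)
    (q : 'I_N -> R) k (H : k.-tuple (S * T)%type -> \bar R) :
  (forall i, measurable (c @^-1` [set i])) ->
  (forall i, Q (c @^-1` [set i]) = (q i)%:E) ->
  measurable_fun setT H -> (forall y, 0 <= H y <= 1) ->
  \int[iid_law U N]_w \int[iid_law Q k]_s
     H (mark c w s) <=
  \int[iid_law (Q \x U)%E k]_y H y + ((k * k)%:R * \sum_(i < N) q i ^+ 2)%:E.
Proof.
move=> mc qE mH H01.
have H0 y : 0 <= H y by case/andP: (H01 y).
have H1 y : H y <= 1 by case/andP: (H01 y).
have mtw := @measurable_mark d d' S T N k c mc.
have mHtw : measurable_fun setT (fun p : N.-tuple T * k.-tuple S =>
    H (mark c p.1 p.2)).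
  exact: measurableT_comp mH mtw.
have mHz : measurable_fun setT (fun p : k.-tuple S * k.-tuple T => H (zip_tuple p.1 p.2)).
  exact: (measurableT_comp mH (@measurable_zip_tuple _ _ _ _ _)).
rewrite (fubini_tonelli (fun p : N.-tuple T * k.-tuple S =>
    H (mark c p.1 p.2)))//.
rewrite -integral_iid_zip//.
pose A (t : 'I_k * 'I_k * 'I_N) (m : 'I_k) : set S :=
  if (m == t.1.1) || (m == t.1.2) then c @^-1` [set t.2] else setT.
have mA t m : measurable (A t m) by rewrite /A; case: ifP.
pose f (t : 'I_k * 'I_k * 'I_N) (s : k.-tuple S) : \bar R :=
  if t.1.1 == t.1.2 then 0 else (\1_(rectangle (A t)) s)%:E.
have f0 t s : 0 <= f t s by rewrite /f; case: ifP => // _; rewrite lee_fin.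
have mf t : measurable_fun setT (f t).
  rewrite /f; case: (t.1.1 == t.1.2); first exact: measurable_cst.
  by apply/measurable_EFinP; apply: measurable_indic; apply: measurable_rectangle.
apply: (@le_trans _ _ (\int[iid_law Q k]_s
   (\int[iid_law U k]_u H (zip_tuple s u) + \sum_t f t s))).
  apply: ge0_le_integral => //.
  - by move=> s _; apply: integral_ge0.
  - exact: (measurable_fun_fubini_tonelli_G _ mHtw).
  - apply: emeasurable_funD; first exact: (measurable_fun_fubini_tonelli_F _ mHz).
    exact: emeasurable_sum.
  move=> s _.
  (* distinct cells: the marks read by s are those of an injective selection *)
  have [inj|] := pselect (injective (fun j => c (tnth s j))).
    rewrite (@integral_iid_select _ _ _ _ N k _ (fun u => H (zip_tuple s u)) inj)//.
      rewrite -[leLHS]adde0 leeD//; last exact: sume_ge0.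
      rewrite le_eqVlt; apply/orP; left; apply/eqP; apply: eq_integral => w _.
      by congr H; apply: eq_from_tnth => j; rewrite !tnth_mktuple.
    exact: (measurable_fun_slice (f := fun p => H (zip_tuple p.1 p.2))).
  move=> /existsNP[j /existsNP[l /not_implyP[/= jl /eqP jDl]]].
  apply: (@le_trans _ _ 1).
    rewrite -[leRHS](_ : \int[iid_law U N]_w (cst 1) w = 1); last first.
      by rewrite integral_cst//= mul1e probability_setT.
    apply: ge0_le_integral => //.
    exact: (measurableT_comp mHtw (@measurable_pair2 _ _ _ _ s)).
  rewrite -[leLHS]add0e; apply: leeD; first exact: integral_ge0.
  rewrite (bigD1 (j, l, c (tnth s j)))//= -[leLHS]adde0; apply: leeD.
    rewrite /f/= (negbTE jDl) indicE mem_set// => m; rewrite /A/=.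
    by case: ifP => // /orP[] /eqP ->/=.
  by apply: sume_ge0 => t _.
rewrite ge0_integralD//; last 4 first.
- by move=> s _; apply: integral_ge0.
- exact: (measurable_fun_fubini_tonelli_F _ mHz).
- by move=> s _; apply: sume_ge0.
- exact: emeasurable_sum.
rewrite leeD2l// ge0_integral_sum//.
apply: (@le_trans _ _ (\sum_t (q t.2 ^+ 2)%:E)).
  apply: lee_sum => -[[j l] i] _; rewrite /f/=; case: eqP => [_|/eqP jl].
    by rewrite integral0 lee_fin sqr_ge0.
  rewrite integral_indic ?setIT//; last exact: measurable_rectangle.
  rewrite [leLHS](iid_law_rectangle Q (mA (j, l, i))).
  rewrite (bigD1 j)//= (bigD1 l)/=; last by rewrite eq_sym.
  rewrite big1 ?mule1.
    by rewrite /A/= !eqxx/= orbT/= qE -EFinM expr2.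
  by move=> m /andP[mj ml]; rewrite /A/= (negbTE mj) (negbTE ml)/= probability_setT.
rewrite sumEFin lee_fin.
rewrite -(pair_big xpredT xpredT (fun (p : 'I_k * 'I_k) (i : 'I_N) => (q i ^+ 2)%R))/=.
by rewrite sumr_const card_prod card_ord mulr_natl.
Qed.

End decouple.

(** * Partitions of R^d into cells that are rarely hit twice *)

Section cells.
Context (R : realType).

(** The cells are the atoms of the algebra generated by B 0, ..., B (m - 1). Two
    independent draws share a cell with probability [\sum_i q i ^+ 2], and as m
    grows these events decrease to the diagonal, which is null by Fubini's
    theorem since points are null. *)
Lemma small_partition d (T : measurableType d) (mu : probability T R)
    (B : nat -> set T) :
  (forall j, measurable (B j)) ->
  (forall x y, (forall j, B j x <-> B j y) -> x = y) ->
  (forall x, mu [set x] = 0) ->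
  forall e : R, (0 < e)%R ->
  exists N (c : T -> 'I_N) (q : 'I_N -> R),
    [/\ forall i, measurable (c @^-1` [set i]),
        forall i, mu (c @^-1` [set i]) = (q i)%:E &
        (\sum_(i < N) q i ^+ 2 <= e)%R].
Proof.
move=> mB sepB mu0 e e0.
pose code m (x : T) : {ffun 'I_m -> bool} := [ffun j : 'I_m => `[< B j x >]].
pose c m (x : T) : 'I_#|{ffun 'I_m -> bool}| := enum_rank (code m x).
have cP m x y : (c m x = c m y) <-> (forall j, (j < m)%N -> (B j x <-> B j y)).
  split => [/enum_rank_inj cxy j jm|h].
    have /ffunP/(_ (Ordinal jm)) := cxy; rewrite !ffunE/=.
    move=> h; split => /asboolP Bj; apply/asboolP; first by rewrite -h.
    by rewrite h.
  by congr enum_rank; apply/ffunP => j; rewrite !ffunE; apply/asbool_equiv_eq/h.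
have mc m i : measurable (c m @^-1` [set i]).
  rewrite (_ : _ @^-1` _ = \bigcap_(j in [set: 'I_m])
      (if enum_val i j then B j else ~` B j)).
    apply: fin_bigcap_measurable => // j _.
    by case: ifP => _; [exact: mB|apply: measurableC; exact: mB].
  apply/seteqP; split => x /=.
    move=> <- j _; rewrite /c enum_rankK ffunE.
    by have [h|h] := asboolP (B j x); exact: h.
  move=> h; rewrite /c -[RHS]enum_valK; congr enum_rank; apply/ffunP => j.
  rewrite ffunE; have := h j I; case: ifP => _ Bj; first by apply/asboolP.
  by apply/asboolP.
pose E m : set (T * T) := [set p | c m p.1 = c m p.2].
have EE m : E m = \big[setU/set0]_(i < #|{ffun 'I_m -> bool}|)
    ((c m @^-1` [set i]) `*` (c m @^-1` [set i])).
  rewrite -bigcup_seq; apply/seteqP; split => [[x y]/= cxy|[x y]].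
    by exists (c m x) => //=; rewrite mem_index_enum.
  by move=> [i _ [/= xi yi]]; rewrite /E/= xi yi.
have mE m : measurable (E m).
  rewrite EE; apply: bigsetU_measurable => i _; exact: measurableX.
have muE m : (mu \x mu) (E m) =
    (\sum_(i < #|{ffun 'I_m -> bool}|) fine (mu (c m @^-1` [set i])) ^+ 2)%:E.
  rewrite EE measure_semi_additive_ord.
  - rewrite -sumEFin; apply: eq_bigr => i _.
    rewrite [LHS]product_measure1E//.
    by rewrite expr2 EFinM fineK// fin_num_measure.
  - by move=> i; exact: measurableX.
  - by apply/trivIsetP => i j _ _ /eqP ij; rewrite -subset0 => -[x y];
      case=> -[/= xi _] [/= xj _]; apply: ij; rewrite -xi -xj.
  - by rewrite -EE.
have niE : nonincreasing_seq E.
  move=> m n mn; apply/subsetPset => -[x y] /cP/= h; apply/cP => j jm.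
  exact/h/(leq_trans jm).
(* a pair that no cell separates lies on the diagonal *)
have diag : (mu \x mu) (\bigcap_m E m) = 0.
  rewrite /product_measure1 integral0_eq// => x _.
  rewrite -(mu0 x); congr (mu _); apply/seteqP; split => y /=.
    rewrite /xsection/= inE => h; apply/esym/sepB => j.
    by have /cP := h j.+1 I; apply.
  by move=> ->; rewrite /xsection/= inE => m _.
have : (mu \x mu) \o E @ \oo --> 0.
  rewrite -diag; apply: nonincreasing_cvg_mu => //.
    by rewrite (le_lt_trans (probability_le1 _ _))// ltry.
  exact: bigcapT_measurable.
move=> /fine_cvgP[_] /cvgrPdist_le /(_ _ e0) [m _ /(_ m)] /= /(_ (leqnn m)).
rewrite muE/= sub0r normrN => h.
exists _, (c m), (fun i => fine (mu (c m @^-1` [set i]))); split => //.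
  by move=> i; rewrite fineK// fin_num_measure.
exact: le_trans (ler_norm _) h.
Qed.

(** The half-spaces bounded by rational coordinates separate the points of R^d.
    The law of the features inherits nonatomicity because there are only two
    labels. *)
Lemma small_cells d (P : probability (example R d) R) : nonatomic P ->
  forall e : R, (0 < e)%R ->
  exists N (c : d.-tuple R -> 'I_N) (q : 'I_N -> R),
    [/\ forall i, measurable (c @^-1` [set i]),
        forall i, P (fst @^-1` (c @^-1` [set i])) = (q i)%:E &
        (\sum_(i < N) q i ^+ 2 <= e)%R].
Proof.
move=> naP.
pose f : {mfun example R d >-> d.-tuple R} :=
  HB.pack fst (isMeasurableFun.Build _ _ (example R d) (d.-tuple R) fst measurable_fst).
pose B j : set (d.-tuple R) :=
  if (unpickle j : option ('I_d * rat)) is Some p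
  then [set x | (ratr p.2 < tnth x p.1)%R] else set0.
apply: (@small_partition _ _ (distribution P f) B).
- move=> j; rewrite /B; case: unpickle => [[i r]/=|]; last exact: measurable0.
  rewrite (_ : [set x | _] = (fun x => tnth x i) @^-1` `]ratr r, +oo[%classic).
    by rewrite -[X in measurable X]setTI; apply: (measurable_tnth i).
  by apply/seteqP; split => x /=; rewrite in_itv/= andbT.
- move=> x y h; apply: eq_from_tnth => i.
  have {}h r : (ratr r < tnth x i)%R = (ratr r < tnth y i)%R.
    have := h (pickle (i, r)); rewrite /B pickleK/= => hr.
    by apply/idP/idP => /hr.
  case: (ltgtP (tnth x i) (tnth y i)) => // xy; have [r] := rat_in_itvoo xy;
    rewrite in_itv/= => /andP[r1 r2].
    by move: r2; rewrite -h ltNge (ltW r1).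
  by move: r2; rewrite h ltNge (ltW r1).
- move=> x.
  transitivity (P ([set (x, true)] `|` [set (x, false)])).
    congr (P _); apply/seteqP; split => [[z []]/= ->|[z b]]; [by left|by right|].
    by case=> -[-> _].
  have mx : measurable [set x].
    rewrite (_ : [set x] = rectangle (fun i => [set tnth x i])).
      by apply: measurable_rectangle => i; exact: measurable_set1.
    apply/seteqP; split => y /=; first by move=> ->.
    by move=> h; exact: eq_from_tnth.
  have mxb (b : bool) : measurable [set (x, b)].
    rewrite (_ : [set _] = [set x] `*` [set b]); first by apply: measurableX.
    by apply/seteqP; split => -[z b'] /=; [case=> -> ->|case=> -> ->].
  rewrite measureU0//; exact: naP.
Qed.

End cells.

(** * Labels generated from a regression function *)

Section labels.
Context (R : realType).

Let idR (x : measurableTypeR R) : R := x.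

Let measurable_idR : measurable_fun setT idR.
Proof. by move=> _ A mA; rewrite setTI. Qed.

HB.instance Definition _ := isMeasurableFun.Build _ _ _ _ idR measurable_idR.

(** The uniform law is transported along the identity to get a law on [R] with
    its default measurable structure, the one that random labels and marks live
    on. *)
Definition unif : probability R R := distribution (uniform_prob (@ltr01 R)) idR.

Lemma integral_unif (f : R -> \bar R) :
  measurable_fun setT f -> (forall x, 0 <= f x) ->
  \int[unif]_x f x = \int[lebesgue_measure]_(x in `[0%R, 1%R]) f x.
Proof.
move=> mf f0.
rewrite (@integral_law _ _ _ _ _ (uniform_prob (@ltr01 R)) _ idR)//.
by rewrite integral_uniform// subr0 invr1 mul1e.
Qed.

Lemma unif_le (t : R) : (0 <= t <= 1)%R -> unif [set v | (v <= t)%R] = t%:E.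
Proof.
move=> /andP[t0 t1].
have mA : measurable [set v : R | (v <= t)%R].
  exact: (_ : measurable `]-oo, t]%classic).
transitivity (\int[unif]_v (\1_[set v : R | (v <= t)%R] v)%:E).
  by rewrite integral_indic// setIT.
rewrite integral_unif//; last by apply/measurable_EFinP; exact: measurable_indic.
rewrite integral_indic// (_ : _ `&` _ = `[0%R, t]%classic).
  by rewrite [LHS](lebesgue_measure_itv `[0%R, t])/= lte_fin; case: ltgtP t0 => // [|<-] _;
     rewrite ?oppr0 ?adde0 ?sube0.
apply/seteqP; split => x /=; rewrite !in_itv/=.
  by move=> [-> /andP[->]].
by move=> /andP[-> xt]; split => //; exact: le_trans t1.
Qed.

(** Comparing a uniform variable with t produces a Bernoulli label of parameter
    t. *)
Lemma integral_label (t : R) (h : bool -> \bar R) : (0 <= t <= 1)%R ->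
  (forall b, 0 <= h b) ->
  \int[unif]_v h (v <= t)%R = t%:E * h true + (1 - t)%:E * h false.
Proof.
move=> t01 h0.
have mA : measurable [set v : R | (v <= t)%R].
  exact: (_ : measurable `]-oo, t]%classic).
pose A := [set v : R | (v <= t)%R].
transitivity (\int[unif]_v (h true * (\1_A v)%:E + h false * (\1_(~` A) v)%:E)).
  apply: eq_integral => v _; rewrite !indicE in_setC.
  have [vA|vA] := boolP (v \in A).
    by rewrite mule1 mule0 adde0; move: vA; rewrite inE /A/= => ->.
  by rewrite mule1 mule0 add0e; move: vA; rewrite notin_setE /A/= => /negP/negbTE ->.
have mI B : measurable B -> measurable_fun setT (fun v : R => (\1_B v)%:E : \bar R).
  by move=> mB; apply/measurable_EFinP; exact: measurable_indic.
rewrite ge0_integralD//; last 4 first.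
- by move=> v _; rewrite mule_ge0// lee_fin.
- by apply: measurable_funeM; exact: mI.
- by move=> v _; rewrite mule_ge0// lee_fin.
- by apply: measurable_funeM; apply: mI; exact: measurableC.
have mIA := mI _ mA.
have mIC := mI _ (measurableC mA).
rewrite !ge0_integralZl//.
rewrite !integral_indic//; last exact: measurableC.
rewrite !setIT.
rewrite muleC [X in _ + X]muleC; congr (_ * _ + _ * _); first exact: unif_le.
by apply: (etrans (probability_setC _ mA)); rewrite unif_le// -EFinB.
Qed.

End labels.

Section relabel.
Context (R : realType) (d : nat).
Local Notation U := (unif R).
Local Notation X := (d.-tuple R).
Implicit Types (P : probability (example R d) R).

Definition label (e : X -> R) (a : example R d * R) : example R d :=
  (a.1.1, (a.2 <= e a.1.1)%R).

Lemma measurable_label (e : {mfun X >-> R}) : measurable_fun setT (label e).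
Proof.
apply: measurable_fun_pair.
  exact: (measurableT_comp measurable_fst measurable_fst).
apply: measurable_fun_ler; first exact: measurable_snd.
apply: (measurableT_comp (measurable_funP e)).
exact: (measurableT_comp measurable_fst measurable_fst).
Qed.

HB.instance Definition _ (e : {mfun X >-> R}) :=
  isMeasurableFun.Build _ _ _ _ (label e) (measurable_label e).

Definition relabel P (e : {mfun X >-> R}) : probability (example R d) R :=
  distribution (P \x U) (label e).

Lemma integral_relabel P (e : {mfun X >-> R}) (h : example R d -> \bar R) :
  (forall x, 0 <= e x <= 1)%R ->
  measurable_fun setT h -> (forall z, 0 <= h z) ->
  \int[relabel P e]_z h z = \int[P]_z
    ((e z.1)%:E * h (z.1, true) + (1 - e z.1)%:E * h (z.1, false)).
Proof.
move=> e01 mh h0.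
rewrite (ge0_integral_distribution (label e))//.
rewrite fubini_tonelli1//.
  apply: eq_integral => z _.
  exact: (@integral_label R (e z.1) (fun b => h (z.1, b)) (e01 z.1)).
  by apply: measurableT_comp => //; exact: measurable_label.
by move=> a; exact: h0.
Qed.

Lemma relabel_regression P (e : {mfun X >-> R}) :
  (forall x, 0 <= e x <= 1)%R -> is_regression_function (relabel P e) e.
Proof.
move=> e01; split => // A mA.
have mfA : measurable (fst @^-1` A : set (example R d)).
  by rewrite -[X in measurable X]setTI; exact: measurable_fst.
have mAe : measurable_fun setT (fun z : example R d => (\1_A z.1 * e z.1)%:E).
  apply/measurable_EFinP; apply: measurable_funM.
    by apply: measurableT_comp => //; exact: measurable_indic.
  exact: measurableT_comp.
have Ae0 (z : example R d) : 0 <= (\1_A z.1 * e z.1)%:E.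
  by rewrite lee_fin mulr_ge0//; case/andP: (e01 z.1).
transitivity (\int[relabel P e]_z (\1_A z.1 * e z.1)%:E).
  rewrite [LHS]integral_mkcond; apply: eq_integral => z _.
  rewrite patchE indicE.
  rewrite (_ : (z \in fst @^-1` A) = (z.1 \in A)); last by apply/idP/idP; rewrite !inE.
  by case: ifP => _; rewrite ?mul1r ?mul0r.
have mAt : measurable (A `*` [set true] : set (example R d)).
  exact: measurableX.
have mI : measurable_fun setT (fun z : example R d => (\1_(A `*` [set true]) z)%:E : \bar R).
  by apply/measurable_EFinP; exact: measurable_indic.
transitivity (\int[relabel P e]_z (\1_(A `*` [set true]) z)%:E); last first.
  by rewrite integral_indic// setIT.
rewrite !integral_relabel//.
apply: eq_integral => z _ /=.
rewrite -!EFinM -!EFinD -mulrDl addrC subrK mul1r !indicE.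
rewrite (_ : ((z.1, true) \in _) = (z.1 \in A)); last first.
  by apply/idP/idP; rewrite !inE => //= -[].
rewrite (_ : ((z.1, false) \in _) = false); last first.
  by apply/negP; rewrite inE => -[].
by rewrite mulr0 addr0 mulrC.
Qed.

(** The defining property of eta concerns the label [true] only; the label
    [false] is obtained by complement, all quantities being finite. *)
Lemma regression_disintegration P (eta : {mfun X >-> R}) (B : set (example R d)) :
  is_regression_function P eta -> measurable B ->
  \int[P]_z ((eta z.1)%:E * (\1_B (z.1, true))%:E +
             (1 - eta z.1)%:E * (\1_B (z.1, false))%:E) = P B.
Proof.
move=> [eta01 etaP] mB.
have meta : measurable_fun setT (fun z : example R d => eta z.1).
  exact: measurableT_comp.
pose S b : set X := [set x | B (x, b)].
have mS b : measurable (S b).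
  rewrite (_ : S b = ysection B b); first exact: measurable_ysection.
  by apply/seteqP; split => x; rewrite /ysection/= inE.
have IS b (z : example R d) : \1_B (z.1, b) = \1_(S b) z.1 :> R.
  by rewrite !indicE; congr ((_ _)%:R); apply/idP/idP; rewrite !inE.
have mSf b : measurable (fst @^-1` S b : set (example R d)).
  by rewrite -[X in measurable X]setTI; exact: measurable_fst.
have mIS b : measurable_fun setT (fun z : example R d => \1_(S b) z.1 : R).
  by apply: measurableT_comp => //; exact: measurable_indic.
have etaS b : \int[P]_z (eta z.1 * \1_(S b) z.1)%:E = P (S b `*` [set true]).
  rewrite -etaP// [RHS]integral_mkcond; apply: eq_integral => z _.
  rewrite patchE indicE.
  rewrite (_ : (z \in fst @^-1` _) = (z.1 \in S b)); last by apply/idP/idP; rewrite !inE.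
  by case: ifP => _; rewrite ?mulr1 ?mulr0.
have e0 z : (0 <= eta z)%R by case/andP: (eta01 z).
have e1 z : (0 <= 1 - eta z)%R by rewrite subr_ge0; case/andP: (eta01 z).
have m1 b : measurable_fun setT (fun z : example R d => (eta z.1 * \1_(S b) z.1)%:E).
  by apply/measurable_EFinP; exact: measurable_funM.
have m2 b : measurable_fun setT (fun z : example R d => ((1 - eta z.1) * \1_(S b) z.1)%:E).
  by apply/measurable_EFinP; apply: measurable_funM => //; exact: measurable_funB.
have mSb b : measurable (S b `*` [set true] : set (example R d)) by exact: measurableX.
have mSb' b : measurable (S b `*` [set false] : set (example R d)) by exact: measurableX.
have compl b : \int[P]_z ((1 - eta z.1) * \1_(S b) z.1)%:E = P (S b `*` [set false]).
  have sumE : P (S b `*` [set true]) + \int[P]_z ((1 - eta z.1) * \1_(S b) z.1)%:E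
      = P (S b `*` [set true]) + P (S b `*` [set false]).
    rewrite -etaS -ge0_integralD//; last 2 first.
    - by move=> z _; rewrite lee_fin mulr_ge0.
    - by move=> z _; rewrite lee_fin mulr_ge0.
    rewrite etaS -measureU//; last first.
      by rewrite -subset0 => -[x y] [[/= _ ->] [_]].
    transitivity (\int[P]_z (\1_(fst @^-1` S b) z)%:E).
      apply: eq_integral => z _; rewrite -EFinD -mulrDl addrC subrK mul1r.
      by rewrite !indicE; congr ((_ _)%:R%:E); apply/idP/idP; rewrite !inE.
    rewrite integral_indic// setIT; congr (P _); apply/seteqP; split.
      by move=> [x []]/= h; [left|right].
    by move=> [x y]/= [] [].
  have pf : P (S b `*` [set true]) \is a fin_num by exact: fin_num_measure.
  by rewrite -[LHS](addeK _ pf) [X in X - _]addeC sumE [X in X - _]addeC addeK.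
transitivity (\int[P]_z ((eta z.1 * \1_(S true) z.1)%:E +
    ((1 - eta z.1) * \1_(S false) z.1)%:E)).
  by apply: eq_integral => z _; rewrite !EFinM !IS.
rewrite ge0_integralD//; last 2 first.
- by move=> z _; rewrite lee_fin mulr_ge0.
- by move=> z _; rewrite lee_fin mulr_ge0.
rewrite etaS compl -measureU//; last first.
  by rewrite -subset0 => -[x y] [[/= _ ->] [_]].
congr (P _); apply/seteqP; split => [[x y]|[x []] Bx]/=.
- by case=> -[h ->].
- by left.
- by right.
Qed.

Lemma integral_compl (f : R -> R) (t : R) :
  measurable_fun setT f -> (forall u, (0 <= f u <= 1)%R) ->
  \int[U]_u (f u)%:E = t%:E -> \int[U]_u (1 - f u)%:E = (1 - t)%:E.
Proof.
move=> mf f01 fE.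
have : t%:E + \int[U]_u (1 - f u)%:E = 1.
  rewrite -fE -ge0_integralD//.
  - rewrite (eq_integral (cst 1)); first by rewrite integral_cst//= mul1e probability_setT.
    by move=> u _; rewrite -EFinD addrC subrK.
  - by move=> u _; rewrite lee_fin; case/andP: (f01 u).
  - exact/measurable_EFinP.
  - by move=> u _; rewrite lee_fin subr_ge0; case/andP: (f01 u).
  - by apply/measurable_EFinP; exact: measurable_funB.
by move=> h; rewrite EFinB -h [X in X - _]addeC addeK.
Qed.

(** Here the argument is ((z, v), u): the example z provides the feature, v is
    the noise that draws the label, and u is the mark. *)
Definition randomized_label (eta : X -> R) (F : R * R -> R)
    (a : (example R d * R) * R) : example R d :=
  (a.1.1.1, (a.1.2 <= F (eta a.1.1.1, a.2))%R).

Lemma measurable_randomized_label (eta : {mfun X >-> R}) (F : R * R -> R) :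
  measurable_fun setT F -> measurable_fun setT (randomized_label eta F).
Proof.
move=> mF.
have m11 := measurableT_comp (@measurable_fst _ _ (example R d) R)
  (@measurable_fst _ _ (example R d * R)%type R).
have m111 := measurableT_comp (@measurable_fst _ _ X bool) m11.
apply: measurable_fun_pair; first exact: m111.
apply: measurable_fun_ler.
  exact: (measurableT_comp (@measurable_snd _ _ (example R d) R)
    (@measurable_fst _ _ (example R d * R)%type R)).
apply: (measurableT_comp mF); apply: measurable_fun_pair => //.
exact: (measurableT_comp (measurable_funP eta) m111).
Qed.

(** Given the feature, the label is true with probability equal to the mean of F
    (eta x, u) over u, which is eta x: randomizing the parameter of a Bernoulli
    variable does not change its law. *)
Lemma randomized_label_law P (eta : {mfun X >-> R}) (F : R * R -> R)
    (B : set (example R d)) :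
  is_regression_function P eta ->
  measurable_fun setT F ->
  (forall t u, (0 <= t <= 1)%R -> (0 <= F (t, u) <= 1)%R) ->
  (forall t, (0 <= t <= 1)%R -> \int[U]_u (F (t, u))%:E = t%:E) ->
  measurable B ->
  P B = ((P \x U) \x U) (randomized_label eta F @^-1` B).
Proof.
move=> etaP mF F01 Fmean mB.
have mL := measurable_randomized_label eta mF.
have eta01 := etaP.1.
have mI : measurable_fun setT (fun z : example R d => (\1_B z)%:E : \bar R).
  by apply/measurable_EFinP; exact: measurable_indic.
have mIL := measurableT_comp mI mL.
transitivity (\int[(P \x U) \x U]_a (\1_B (randomized_label eta F a))%:E); last first.
  have mLB : measurable (randomized_label eta F @^-1` B).
    by rewrite -[X in measurable X]setTI; exact: mL.
  transitivity (\int[(P \x U) \x U]_a (\1_(randomized_label eta F @^-1` B) a)%:E).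
    by apply: eq_integral => a _; rewrite !indicE; congr ((nat_of_bool _)%:R%:E).
  by rewrite (integral_indic _ measurableT mLB) setIT.
rewrite (integral_triple123 _ _ _ mIL); last by move=> a; rewrite lee_fin.
rewrite -(regression_disintegration etaP mB); apply: eq_integral => z _.
have mz : measurable_fun setT
    (fun p : R * R => (\1_B (randomized_label eta F ((z, p.1), p.2)))%:E : \bar R).
  apply: (measurableT_comp mIL (g := fun p : R * R => ((z, p.1), p.2))).
  by apply: measurable_fun_pair => //; apply: measurable_fun_pair.
rewrite (fubini_tonelli (fun p : R * R => (\1_B (randomized_label eta F ((z, p.1), p.2)))%:E))//.
rewrite /randomized_label/=.
under eq_integral => u _ do
  rewrite (integral_label (h := fun b => (\1_B (z.1, b))%:E) (F01 _ u (eta01 z.1)))//.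
have mFz : measurable_fun setT (fun u => F (eta z.1, u)).
  exact: measurable_fun_slice.
have F0 u : (0 <= F (eta z.1, u))%R by case/andP: (F01 _ u (eta01 z.1)).
have F1 u : (0 <= 1 - F (eta z.1, u))%R by rewrite subr_ge0; case/andP: (F01 _ u (eta01 z.1)).
have mE : measurable_fun setT (fun u => (F (eta z.1, u))%:E) by exact/measurable_EFinP.
have mE1 : measurable_fun setT (fun u => (1 - F (eta z.1, u))%:E).
  by apply/measurable_EFinP; exact: measurable_funB.
rewrite ge0_integralD//=.
- rewrite !ge0_integralZr//.
  + rewrite Fmean// (integral_compl mFz _ (Fmean _ (eta01 z.1)))//.
    by move=> u; exact: F01.
  + by move=> u _; rewrite lee_fin.
  + by move=> u _; rewrite lee_fin.
- by move=> u _; rewrite mule_ge0// lee_fin.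
- exact: emeasurable_funM.
- by move=> u _; rewrite mule_ge0// lee_fin.
- exact: emeasurable_funM.
Qed.

End relabel.

(** * Coverage of a randomized version of the regression function *)

Section transfer.
Context (R : realType) (n d : nat) (dXi : measure_display) (Xi : measurableType dXi).
Local Notation U := (unif R).
Local Notation X := (d.-tuple R).
Local Notation T := (example R d).

Variables (nu : probability Xi R) (alpha : R) (C : algorithm R d n Xi).
Hypothesis mC : measurable_algorithm C.

(** The coverage indicator as a function of data, seed, point and value, so that
    every probability below is an iterated integral of one measurable function. *)
Definition covers (w : (n.-tuple T * Xi) * X * R) : \bar R :=
  (\1_[set w | C w.1.1.1 w.1.1.2 w.1.2 w.2] w)%:E.

Lemma measurable_covers : measurable_fun setT covers.
Proof. by apply/measurable_EFinP; exact: measurable_indic. Qed.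

Lemma covers_ge0 w : 0 <= covers w. Proof. by rewrite lee_fin. Qed.

Lemma covers_le1 w : covers w <= 1.
Proof. by rewrite lee_fin indicE; case: (_ \in _). Qed.

Variables (P : probability T R) (eta : {mfun X >-> R}) (F : R * R -> R).
Hypothesis etaP : is_regression_function P eta.
Hypothesis mF : measurable_fun setT F.
Hypothesis F01 : forall t u, (0 <= t <= 1)%R -> (0 <= F (t, u) <= 1)%R.
Hypothesis Fmean : forall t, (0 <= t <= 1)%R -> \int[U]_u (F (t, u))%:E = t%:E.

(** Position 0 is the test point and the positions 1, ..., n are the training
    sample. The test point enters through its feature and its mark only. *)
Definition marked_coverage (xi : Xi) (y : n.+1.-tuple ((T * R) * R)%type) : \bar R :=
  covers ((([tuple randomized_label eta F (tnth y (lift ord0 i)) | i < n], xi),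
           (tnth y ord0).1.1.1),
          F (eta (tnth y ord0).1.1.1, (tnth y ord0).2)).

Lemma measurable_marked_coverage :
  measurable_fun setT (fun p : Xi * n.+1.-tuple ((T * R) * R)%type =>
    marked_coverage p.1 p.2).
Proof.
apply: (measurableT_comp measurable_covers).
have m0 : measurable_fun setT (fun p : Xi * n.+1.-tuple ((T * R) * R)%type => tnth p.2 ord0).
  exact: (measurableT_comp (@measurable_tnth _ _ _ ord0) measurable_snd).
have mx : measurable_fun setT
    (fun p : Xi * n.+1.-tuple ((T * R) * R)%type => (tnth p.2 ord0).1.1.1).
  apply: (measurableT_comp (@measurable_fst _ _ X bool)).
  apply: (measurableT_comp (@measurable_fst _ _ T R)).
  exact: (measurableT_comp (@measurable_fst _ _ (T * R)%type R) m0).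
apply: measurable_fun_pair.
  apply: measurable_fun_pair => //; apply: measurable_fun_pair => //.
  apply: measurable_mktuple => i.
  apply: (measurableT_comp (measurable_randomized_label eta mF)).
  exact: (measurableT_comp (@measurable_tnth _ _ _ (lift ord0 i)) measurable_snd).
apply: (measurableT_comp mF); apply: measurable_fun_pair.
  exact: (measurableT_comp (measurable_funP eta) mx).
exact: (measurableT_comp (@measurable_snd _ _ (T * R)%type R) m0).
Qed.

Section one_marking.
Variables (N : nat) (c : X -> 'I_N) (w : N.-tuple R).
Hypothesis mc : forall i, measurable (c @^-1` [set i]).

Definition cell_regression (x : X) : R := F (eta x, tnth w (c x)).

Lemma measurable_cell_regression : measurable_fun setT cell_regression.
Proof.
apply: (measurableT_comp mF); apply: measurable_fun_pair => //.
move=> _ B mB; rewrite setTI.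
rewrite (_ : _ @^-1` _ = \bigcup_(i in [set i | B (tnth w i)]) (c @^-1` [set i])).
  by apply: fin_bigcup_measurable => // i _; exact: mc.
apply/seteqP; split => x /=; first by exists (c x).
by move=> [i /= Bi ci]; rewrite ci.
Qed.

HB.instance Definition _ :=
  isMeasurableFun.Build _ _ _ _ cell_regression measurable_cell_regression.

(** With the marks [w] frozen, [cell_regression] is an ordinary regression
    function, that of the relabelled distribution, and the coverage guarantee
    applies. *)
Lemma marked_coverage_ge :
  distribution_free_CI nu alpha C ->
  (1 - alpha)%:E <= \int[nu]_xi \int[iid_law (P \x U)%E n.+1]_s
    marked_coverage xi (mark (fun a => c a.1.1) w s).
Proof.
move=> /(_ (relabel P cell_regression) cell_regression) hC.
have e01 x : (0 <= cell_regression x <= 1)%R by apply: F01; exact: etaP.1.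
apply: (le_trans (hC (relabel_regression P e01))).
pose g (a : (n.-tuple T * Xi) * T) : \bar R :=
  covers ((a.1, a.2.1), cell_regression a.2.1).
have mg : measurable_fun setT g.
  apply: (measurableT_comp measurable_covers).
  have m1 : measurable_fun setT (fun a : (n.-tuple T * Xi) * T => a.2.1).
    exact: (measurableT_comp (@measurable_fst _ _ X bool) measurable_snd).
  apply: measurable_fun_pair; first by apply: measurable_fun_pair.
  exact: (measurableT_comp measurable_cell_regression m1).
have mE : measurable [set a : (n.-tuple T * Xi) * T |
    C a.1.1 a.1.2 a.2.1 (cell_regression a.2.1)].
  rewrite -[X in measurable X]setTI.
  rewrite (_ : [set a | _] = g @^-1` [set 1]); first by apply: mg => //; exact: emeasurable_set1.
  apply/seteqP; split => a /=; rewrite /g/covers/= indicE.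
    by move=> h; rewrite mem_set.
  by case: (boolP (_ \in _)) => [|_ [] /eqP]; rewrite ?inE// eq_sym oner_eq0.
have -> : experiment n nu (relabel P cell_regression)
      [set a | C a.1.1 a.1.2 a.2.1 (cell_regression a.2.1)]
    = \int[experiment n nu (relabel P cell_regression)]_a g a.
  by apply/esym/(etrans (integral_indic _ measurableT mE)); rewrite setIT.
rewrite /experiment integral_triple231//; last by move=> a; exact: covers_ge0.
rewrite le_eqVlt; apply/orP; left; apply/eqP; apply: eq_integral => xi _.
have mgx : measurable_fun setT (fun p : T * n.-tuple T => g ((p.2, xi), p.1)).
  apply: (measurableT_comp mg (g := fun p : T * n.-tuple T => ((p.2, xi), p.1))).
  by apply: measurable_fun_pair => //; apply: measurable_fun_pair.
have g0 a : 0 <= g a by exact: covers_ge0.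
rewrite (ge0_integral_distribution (label cell_regression)); last 2 first.
- exact: (measurable_fun_fubini_tonelli_F _ mgx).
- by move=> z; exact: integral_ge0.
have mmc : measurable_fun setT (fun s : n.+1.-tuple (T * R)%type =>
    marked_coverage xi (mark (fun a => c a.1.1) w s)).
  have mc' i : measurable ((fun a : T * R => c a.1.1) @^-1` [set i]).
    have := measurableT_comp (@measurable_fst _ _ X bool) (@measurable_fst _ _ T R).
    by move=> /(_ measurableT _ (mc i)); rewrite setTI.
  have mm := measurableT_comp (@measurable_mark _ _ (T * R)%type R N n.+1 _ mc')
    (@pair1_measurable _ _ _ _ w).
  apply: (measurableT_comp measurable_marked_coverage
    (g := fun s => (xi, mark (fun a => c a.1.1) w s))).
  exact: measurable_fun_pair.
rewrite integral_iid_cons//; last by move=> y; exact: covers_ge0.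
apply: eq_integral => a _ /=.
rewrite (@integral_iid_map _ _ _ _ _ (P \x U)%E (relabel P cell_regression)
  (label cell_regression))//.
- apply: eq_integral => s _.
  rewrite /g /marked_coverage/= tnth_mktuple tnth0/=; congr covers; congr (_, _, _, _).
  apply: eq_from_tnth => i; rewrite !tnth_mktuple tnthS /label/randomized_label/=.
  by [].
- exact: (measurable_fun_slice (f := fun p : T * n.-tuple T => g ((p.2, xi), p.1))).
Qed.
End one_marking.

Definition coverage (x : X) (t : R) : \bar R :=
  \int[nu]_xi \int[iid_law P n]_D covers (((D, xi), x), t).

Lemma integral_marked_coverage xi :
  \int[iid_law ((P \x U) \x U)%E n.+1]_y marked_coverage xi y =
  \int[(P \x U)]_a \int[U]_u \int[iid_law P n]_D
     covers (((D, xi), a.1.1), F (eta a.1.1, u)).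
Proof.
have mmc : measurable_fun setT (marked_coverage xi).
  exact: (measurable_fun_slice (f := fun p : Xi * n.+1.-tuple ((T * R) * R)%type =>
    marked_coverage p.1 p.2) _ measurable_marked_coverage).
rewrite integral_iid_cons//; last by move=> y; exact: covers_ge0.
have mG : measurable_fun setT (fun p : ((T * R) * R) * n.-tuple T =>
    covers (((p.2, xi), p.1.1.1.1), F (eta p.1.1.1.1, p.1.2))).
  apply: (measurableT_comp measurable_covers).
  have m1 := measurableT_comp (@measurable_fst _ _ (T * R)%type R)
    (@measurable_fst _ _ ((T * R) * R)%type (n.-tuple T)).
  have m2 := measurableT_comp (@measurable_fst _ _ X bool)
    (measurableT_comp (@measurable_fst _ _ T R) m1).
  have m3 := measurableT_comp (@measurable_snd _ _ (T * R)%type R)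
    (@measurable_fst _ _ ((T * R) * R)%type (n.-tuple T)).
  apply: measurable_fun_pair.
    by apply: measurable_fun_pair => //; apply: measurable_fun_pair.
  apply: (measurableT_comp mF); apply: measurable_fun_pair => //.
  exact: (measurableT_comp (measurable_funP eta) m2).
transitivity (\int[((P \x U) \x U)]_z \int[iid_law P n]_D
     covers (((D, xi), z.1.1.1), F (eta z.1.1.1, z.2))).
  apply: eq_integral => z _.
  rewrite (@integral_iid_map _ _ _ _ _ ((P \x U) \x U)%E P (randomized_label eta F))//.
  - apply: eq_integral => s _; rewrite /marked_coverage/= tnth0.
    congr covers; congr (_, _, _, _).
    by apply: eq_from_tnth => i; rewrite !tnth_mktuple tnthS.
  - exact: measurable_randomized_label.
  - by move=> B mB; exact: randomized_label_law.
  - exact: (measurable_fun_slice (f := fun p : ((T * R) * R) * n.-tuple T =>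
      covers (((p.2, xi), p.1.1.1.1), F (eta p.1.1.1.1, p.1.2)))).
  - by move=> y; exact: covers_ge0.
pose PU : probability (T * R)%type R := (P \x U)%E.
transitivity (\int[PU \x U]_z \int[iid_law P n]_D
     covers (((D, xi), z.1.1.1), F (eta z.1.1.1, z.2))); first by [].
rewrite fubini_tonelli1//.
  by apply: (measurable_fun_fubini_tonelli_F _ mG) => p; exact: covers_ge0.
by move=> z; apply: integral_ge0 => D _; exact: covers_ge0.
Qed.

(** The guarantee holds for every choice of marks, hence on average over i.i.d.
    marks; decoupling then replaces cell marks by fresh ones at the price of the
    collision probability, and fresh marks turn the training sample into an
    i.i.d. sample from P. *)
Theorem coverage_randomized_value : nonatomic P ->
  distribution_free_CI nu alpha C ->
  (1 - alpha)%:E <= \int[P]_z \int[U]_u coverage z.1 (F (eta z.1, u)).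
Proof.
move=> naP hC; apply/lee_addgt0Pr => e e0.
(* decoupling n + 1 draws costs (n + 1) ^ 2 times the collision probability *)
have e'0 : (0 < e / (n.+1 * n.+1)%:R)%R by rewrite divr_gt0// ltr0n.
have [N [c [q [mc qE qe]]]] := small_cells naP e'0.
pose c' (a : T * R) := c a.1.1.
have mc' i : measurable (c' @^-1` [set i]).
  have := measurableT_comp (@measurable_fst _ _ X bool) (@measurable_fst _ _ T R).
  by move=> /(_ measurableT _ (mc i)); rewrite setTI.
pose Q : probability (T * R)%type R := (P \x U)%E.
have qE' i : Q (c' @^-1` [set i]) = (q i)%:E.
  transitivity ((P \x U) ((fst @^-1` (c @^-1` [set i])) `*` setT)).
    by congr (_ _); apply/seteqP; split => [[z v]|[z v] []].
  rewrite product_measure1E//; last first.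
    by have := @measurable_fst _ _ X bool measurableT _ (mc i); rewrite setTI.
  by rewrite [X in _ * X](_ : _ = 1); [rewrite mule1; exact: qE|exact: probability_setT].
have mm : measurable_fun setT (fun p : N.-tuple R * (Xi * n.+1.-tuple (T * R)%type) =>
    marked_coverage p.2.1 (mark c' p.1 p.2.2)).
  apply: (measurableT_comp measurable_marked_coverage
    (g := fun p : N.-tuple R * (Xi * n.+1.-tuple (T * R)%type) =>
      (p.2.1, mark c' p.1 p.2.2))).
  apply: measurable_fun_pair; first exact: measurableT_comp.
  apply: (measurableT_comp (@measurable_mark _ _ (T * R)%type R N n.+1 _ mc')
    (g := fun p : N.-tuple R * (Xi * n.+1.-tuple (T * R)%type) => (p.1, p.2.2))).
  by apply: measurable_fun_pair => //; exact: measurableT_comp.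
have mm' : measurable_fun setT (fun p : (N.-tuple R * Xi) * n.+1.-tuple (T * R)%type =>
    marked_coverage p.1.2 (mark c' p.1.1 p.2)).
  apply: (measurableT_comp mm (g := fun p : (N.-tuple R * Xi) * n.+1.-tuple (T * R)%type =>
    (p.1.1, (p.1.2, p.2)))).
  apply: measurable_fun_pair; first exact: measurableT_comp.
  by apply: measurable_fun_pair => //; exact: measurableT_comp.
have mc0 xi y : 0 <= marked_coverage xi y by exact: covers_ge0.
have mF3 := measurable_fun_fubini_tonelli_F (m2 := iid_law Q n.+1) _ mm' (fun p => mc0 _ _).
rewrite /fubini_F in mF3.
apply: (@le_trans _ _ (\int[iid_law U N]_w \int[nu]_xi \int[iid_law Q n.+1]_s
    marked_coverage xi (mark c' w s))).
  have [a0|a0] := leP 0%R (1 - alpha)%R; last first.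
    apply: (@le_trans _ _ 0); first by rewrite lee_fin ltW.
    by apply: integral_ge0 => w _; apply: integral_ge0 => xi _; exact: integral_ge0.
  rewrite -[leLHS](_ : \int[iid_law U N]_w cst (1 - alpha)%:E w = _); last first.
    by rewrite integral_cst//= probability_setT mule1.
  apply: ge0_le_integral => //.
  - apply: (measurable_fun_fubini_tonelli_F _ mF3) => p.
    exact: integral_ge0.
  - move=> w _; exact: marked_coverage_ge.
rewrite (fubini_tonelli (fun p : N.-tuple R * Xi => \int[iid_law Q n.+1]_s
    marked_coverage p.2 (mark c' p.1 s)))//; last by move=> p; exact: integral_ge0.
have mcov xi : measurable_fun setT (marked_coverage xi).
  exact: (measurable_fun_slice (f := fun p : Xi * n.+1.-tuple ((T * R) * R)%type =>
    marked_coverage p.1 p.2) _ measurable_marked_coverage).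
pose h (xi : Xi) := \int[iid_law ((P \x U) \x U)%E n.+1]_y marked_coverage xi y.
have mh : measurable_fun setT h.
  exact: (measurable_fun_fubini_tonelli_F _ measurable_marked_coverage).
have h0 xi : 0 <= h xi by exact: integral_ge0.
apply: (@le_trans _ _ (\int[nu]_xi (h xi + e%:E))).
  apply: ge0_le_integral => //.
  - by move=> xi _; apply: integral_ge0 => w _; exact: integral_ge0.
  - apply: (measurable_fun_fubini_tonelli_G _ mF3) => p.
    exact: integral_ge0.
  - by apply: emeasurable_funD.
  move=> xi _; apply: (le_trans (decouple U mc' qE' (mcov xi) _)).
    by move=> y; rewrite covers_ge0 covers_le1.
  apply: leeD => //; rewrite lee_fin -ler_pdivlMl ?ltr0n// mulrC; exact: qe.
rewrite ge0_integralD//; last by move=> xi _; rewrite lee_fin ltW.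
have -> : \int[nu]_xi e%:E = e%:E.
  by rewrite (integral_cst nu measurableT)/= probability_setT mule1.
apply: leeD => //.
pose k (p : (Xi * T) * R) : \bar R :=
  \int[iid_law P n]_D covers (((D, p.1.1), p.1.2.1), F (eta p.1.2.1, p.2)).
have mk : measurable_fun setT k.
  apply: (measurable_fun_fubini_tonelli_F (fun p : ((Xi * T) * R) * n.-tuple T =>
    covers (((p.2, p.1.1.1), p.1.1.2.1), F (eta p.1.1.2.1, p.1.2)))); last first.
    by move=> p; exact: covers_ge0.
  apply: (measurableT_comp measurable_covers).
  have m1 := @measurable_fst _ _ ((Xi * T) * R)%type (n.-tuple T).
  have m2 := measurableT_comp (@measurable_fst _ _ (Xi * T)%type R) m1.
  have m3 := measurableT_comp (@measurable_fst _ _ X bool)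
    (measurableT_comp (@measurable_snd _ _ Xi T) m2).
  apply: measurable_fun_pair.
    apply: measurable_fun_pair => //; apply: measurable_fun_pair => //.
    exact: (measurableT_comp (@measurable_fst _ _ Xi T) m2).
  apply: (measurableT_comp mF); apply: measurable_fun_pair.
    exact: (measurableT_comp (measurable_funP eta) m3).
  exact: (measurableT_comp (@measurable_snd _ _ (Xi * T)%type R) m1).
have k0 p : 0 <= k p by apply: integral_ge0 => D _; exact: covers_ge0.
have mk1 : measurable_fun setT (fun p : Xi * T => \int[U]_u k (p, u)).
  exact: (measurable_fun_fubini_tonelli_F _ mk).
rewrite le_eqVlt; apply/orP; left; apply/eqP.
transitivity (\int[nu]_xi \int[P]_z \int[U]_u k ((xi, z), u)).
  apply: eq_integral => xi _; rewrite /h integral_marked_coverage.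
  rewrite (fubini_tonelli1 (fun a : T * R => \int[U]_u k ((xi, a.1), u))).
  - apply: eq_integral => z _; rewrite /fubini_F/=.
    rewrite (integral_cst U measurableT) [X in _ * X](_ : _ = 1) ?mule1//.
    exact: probability_setT.
  - apply: (measurableT_comp mk1 (g := fun a : T * R => (xi, a.1))).
    exact: measurable_fun_pair.
  - by move=> a; exact: integral_ge0.
rewrite (fubini_tonelli (fun p : Xi * T => \int[U]_u k (p, u)))//; last first.
  by move=> p; exact: integral_ge0.
apply: eq_integral => z _.
rewrite (fubini_tonelli (fun p : Xi * R => k ((p.1, z), p.2)))//.
apply: (measurableT_comp mk (g := fun p : Xi * R => ((p.1, z), p.2))).
by apply: measurable_fun_pair => //; apply: measurable_fun_pair.
Qed.
End transfer.

(** * A law with a uniform part and an atom *)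

Section kernel.
Context (R : realType).
Local Notation U := (unif R).
Local Notation leb := (@lebesgue_measure R).

(** No regularity of g is needed: the image of Lebesgue measure under an affine
    map is a multiple of Lebesgue measure, as seen on intervals. *)
Lemma integral_affine (l b x y : R) (g : R -> \bar R) : (0 < l)%R ->
  measurable_fun setT g -> (forall z, 0 <= g z) ->
  l%:E * \int[leb]_(u in `[x, y]) g (b + l * u)%R =
  \int[leb]_(z in `[(b + l * x)%R, (b + l * y)%R]) g z.
Proof.
move=> l0 mg g0.
pose aff (u : measurableTypeR R) : measurableTypeR R := (b + l * u)%R.
have maff : measurable_fun setT aff.
  apply: measurable_funD => //; exact: measurable_funM.
pose aff' : {mfun measurableTypeR R >-> measurableTypeR R} :=
  HB.pack aff (isMeasurableFun.Build _ _ _ _ aff maff).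
pose k : {nonneg R} := NngNum (ltW l0).
have affE (i : bool) (p q : R) (j : bool) :
    aff @^-1` [set` Interval (BSide i (b + l * p)%R) (BSide j (b + l * q)%R)] =
    [set` Interval (BSide i p) (BSide j q)].
  by case: i; case: j; apply/seteqP; split => u;
    rewrite /= !in_itv/= /aff ?lerD2l ?ltrD2l ?ler_pM2l// ?ltr_pM2l.
have lebE : forall A : set (measurableTypeR R), measurable A ->
    leb A = mscale k (pushforward leb aff') A.
  move=> maff'; apply: lebesgue_measure_unique => _ [[p q]/= pq <-].
  rewrite /mscale/= /pushforward.
  have [p' pE] : exists p', p = (b + l * p')%R.
    by exists ((p - b) / l)%R; rewrite mulrC divfK ?gt_eqF// addrC subrK.
  have [q' qE] : exists q', q = (b + l * q')%R.
    by exists ((q - b) / l)%R; rewrite mulrC divfK ?gt_eqF// addrC subrK.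
  rewrite {}pE {}qE in pq *.
  rewrite affE.
  rewrite !lebesgue_measure_itv/= !lte_fin ltrD2l ltr_pM2l//.
  case: ifP => _; last by rewrite mule0.
  by rewrite -!EFinB -EFinM; congr EFin; ring.
rewrite [RHS](eq_measure_integral (mscale k (pushforward leb aff'))); last first.
  by move=> A mA _; exact: lebE.
rewrite ge0_integral_mscale//=; last exact: measurable_funTS.
rewrite ge0_integral_pushforward//=; last exact: measurable_funTS.
by rewrite affE.
Qed.

Lemma integral_id (x y : R) : (0 <= x <= y)%R ->
  \int[leb]_(z in `[x, y]) (`|z|)%:E = ((y ^+ 2 - x ^+ 2) / 2)%:E.
Proof.
move=> /andP[x0]; rewrite le_eqVlt => /predU1P[<-|xy].
  by rewrite set_itv1 integral_set1 subrr mul0r.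
transitivity (\int[leb]_(z in `[x, y]) (z%:E)).
  apply: eq_integral => z; rewrite inE/= in_itv/= => /andP[xz _].
  by rewrite ger0_norm// (le_trans x0).
have cF (z : R) : {for z, continuous (fun z : R => z ^+ 2 / 2)%R}.
  by apply: differentiable_continuous; apply/derivable1_diffP; exact: ex_derive.
rewrite (@continuous_FTC2 R id (fun z => z ^+ 2 / 2)%R x y xy).
- by rewrite -EFinB mulrBl.
- by apply: continuous_subspaceT => z; exact: cvg_id.
- split.
  + by move=> z _; exact: ex_derive.
  + by apply: cvg_at_right_filter; exact: cF.
  + by apply: cvg_at_left_filter; exact: cF.
- by move=> z _; rewrite derive1E derive_val /GRing.scale/=; field.
Qed.

Section sampler.
Variables (l : R) (w b p : R).
Hypothesis l0 : (0 < l)%R.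
Hypothesis w0 : (0 <= w)%R.
Hypothesis wl : (w <= l)%R.
Hypothesis b0 : (0 <= b)%R.
Hypothesis bw1 : (b + w <= 1)%R.
Hypothesis p01 : (0 <= p <= 1)%R.

(** For u uniform on [0, 1] the value has density 1/l on [b, b + w] and an atom
    of mass 1 - w/l at p. Values of u outside [0, 1] are sent to p, which keeps
    the range inside [0, 1] without an assumption on u. *)
Definition sampler (u : R) : R := if (0 <= u)%R && (l * u <= w)%R then (b + l * u)%R else p.

Lemma sampler01 u : (0 <= sampler u <= 1)%R.
Proof.
rewrite /sampler; case: ifP => // /andP[u0 ul]; apply/andP; split.
  by rewrite addr_ge0// mulr_ge0// ltW.
by rewrite (le_trans _ bw1)// lerD2l.
Qed.

Lemma measurable_sampler : measurable_fun setT sampler.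
Proof.
apply: measurable_fun_ifT => //.
  by apply: measurable_and; apply: measurable_fun_ler.
by apply: measurable_funD => //; exact: measurable_funM.
Qed.

Lemma integral_sampler (g : R -> \bar R) :
  measurable_fun setT g -> (forall z, 0 <= g z) ->
  l%:E * \int[U]_u g (sampler u) =
  \int[leb]_(z in `[b, (b + w)%R]) g z + (l - w)%:E * g p.
Proof.
move=> mg g0.
have mgs : measurable_fun setT (g \o sampler).
  exact: measurableT_comp mg measurable_sampler.
rewrite integral_unif//.
have wl1 : (w / l <= 1)%R by rewrite ler_pdivrMr// mul1r.
have wl0 : (0 <= w / l)%R by rewrite divr_ge0// ltW.
have -> : `[0%R, 1%R]%classic = `[0%R, (w / l)%R] `|` `](w / l)%R, 1%R] :> set R.
  by rewrite -itv_bndbnd_setU// bnd_simp.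
rewrite ge0_integral_setU//; last 2 first.
- exact: measurable_funTS.
- rewrite disj_set2E; apply/eqP; rewrite -subset0 => u [] /=; rewrite !in_itv/=.
  by move=> /andP[_ h1] /andP[h2 _]; move: (le_lt_trans h1 h2); rewrite ltxx.
rewrite ge0_muleDr; last 2 first.
- exact: integral_ge0.
- exact: integral_ge0.
congr (_ + _).
  transitivity (l%:E * \int[leb]_(u in `[0%R, (w / l)%R]) g (b + l * u)%R).
    congr (_ * _); apply: eq_integral => u; rewrite inE/= in_itv/= => /andP[u0 uw].
    by rewrite /sampler u0 mulrC -ler_pdivlMr// uw mulrC.
  by rewrite integral_affine// mulr0 addr0 mulrC divfK// gt_eqF.
transitivity (l%:E * \int[leb]_(u in `](w / l)%R, 1%R]) cst (g p) u).
  congr (_ * _); apply: eq_integral => u; rewrite inE/= in_itv/= => /andP[wu _].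
  by rewrite /sampler [(l * u)%R]mulrC -ler_pdivlMr// [(u <= w / l)%R]leNgt wu andbF.
rewrite integral_cst// [X in _ * (_ * X)](_ : _ = (1 - w / l)%:E).
  by rewrite [g p * _]muleC muleA -EFinM mulrBr mulr1 mulrCA divff ?mulr1// gt_eqF.
rewrite [LHS](lebesgue_measure_itv `](w / l)%R, 1%R])/= lte_fin; case: ifPn; first by rewrite EFinB.
by rewrite -leNgt => h; rewrite (_ : w / l = 1)%R ?subrr//; apply/eqP; rewrite eq_le wl1 h.
Qed.

Lemma sampler_mean (t : R) : (w ^+ 2 / 2 + b * w + (l - w) * p = l * t)%R ->
  \int[U]_u (sampler u)%:E = t%:E.
Proof.
move=> tE.
have ms := measurable_sampler.
have : l%:E * \int[U]_u (sampler u)%:E = (l * t)%:E.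
  have -> : \int[U]_u (sampler u)%:E = \int[U]_u (`|sampler u|)%:E.
    apply: eq_integral => u _; rewrite ger0_norm//.
    by case/andP: (sampler01 u).
  rewrite -tE.
  rewrite (integral_sampler (g := fun z => (`|z|)%:E)).
  - rewrite integral_id; last by rewrite b0/= lerDl.
    rewrite ger0_norm; last by case/andP: p01.
    by rewrite -EFinM -EFinD; congr EFin; field.
  - by apply/measurable_EFinP; exact: normr_measurable.
  - by move=> z; rewrite lee_fin.
move=> /(congr1 (fun x => (l^-1)%:E * x)).
have lN0 : (l != 0)%R by rewrite gt_eqF.
by rewrite /= muleA -!EFinM mulVf// mul1e mulKf.
Qed.

(** Since the uniform part has density 1/l, the multiplier l turns its
    contribution into the plain integral of c over an interval of length w, and
    the atom contributes at most its mass. *)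
Lemma sampler_trade_off (c : R -> \bar R) :
  measurable_fun setT c -> (forall z, 0 <= c z <= 1) ->
  l%:E * \int[U]_u c (sampler u) + w%:E <= \int[U]_z c z + l%:E.
Proof.
move=> mc c01.
have c0 z : 0 <= c z by case/andP: (c01 z).
have c1 z : c z <= 1 by case/andP: (c01 z).
rewrite integral_sampler// integral_unif// -addeA; apply: leeD.
  apply: ge0_subset_integral => //.
  - exact: measurable_funTS.
  - move=> z /=; rewrite !in_itv/= => /andP[bz zb].
    by rewrite (le_trans b0 bz) (le_trans zb bw1).
rewrite -[leRHS](_ : (l - w)%:E * 1 + w%:E = _); last first.
  by rewrite mule1 -EFinD subrK.
by rewrite leeD2r// lee_wpmul2l// lee_fin subr_ge0.
Qed.

End sampler.

End kernel.

(** * From coverage to expected length *)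

Section optimal_kernel.
Context (R : realType).
Implicit Types (l s t u : R).
Local Open Scope ring_scope.

(** The problem is symmetric under t |-> 1 - t; everything is computed for the
    smaller of the two values. *)
Definition fold_half t : R := if t <= 1 / 2 then t else 1 - t.

(** In the three regimes the uniform part is an interval of full mass centred at
    s; an interval [0, w] with the remaining mass at 0, where mean s forces w ^+
    2 = 2 * l * s; and the whole of [0, 1] with the remaining mass at the point
    that makes the mean equal to s. *)
Definition low_width l s : R :=
  if l <= 2 * s then l else if 2 * l * s <= 1 then Num.sqrt (2 * l * s) else 1.
Definition low_base l s : R := if l <= 2 * s then s - l / 2 else 0.
Definition low_atom l s : R :=
  if 2 * l * s <= 1 then 0 else (2 * l * s - 1) / (2 * (l - 1)).

Definition width l t : R := low_width l (fold_half t).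
(** For t > 1/2 the law is the mirror image of the one for 1 - t. *)
Definition base l t : R :=
  if t <= 1 / 2 then low_base l t else 1 - low_base l (1 - t) - width l t.
Definition atom l t : R :=
  if t <= 1 / 2 then low_atom l t else 1 - low_atom l (1 - t).

Lemma fold_half_itv t : 0 <= t <= 1 -> 0 <= fold_half t <= 1 / 2.
Proof.
move=> /andP[t0 t1]; rewrite /fold_half.
by case: (leP t (1 / 2)) => h; apply/andP; split; lra.
Qed.

Lemma low_parametersP l s : 0 < l -> 0 <= s <= 1 / 2 ->
  [/\ 0 <= low_width l s <= l, 0 <= low_base l s,
      low_base l s + low_width l s <= 1,
      0 <= low_atom l s <= 1 &
      low_width l s ^+ 2 / 2 + low_base l s * low_width l s +
      (l - low_width l s) * low_atom l s = l * s].
Proof.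
move=> l0 /andP[s0 s1]; rewrite /low_width /low_base /low_atom.
case: (leP l (2 * s)) => ls.
  rewrite (_ : 2 * l * s <= 1); last by nra.
  by split; [apply/andP; split; lra|lra|lra|by rewrite lexx ler01|field].
case: (leP (2 * l * s) 1) => ls1.
  have ls0 : 0 <= 2 * l * s by nra.
  have sq := sqr_sqrtr ls0; have sq0 := sqrtr_ge0 (2 * l * s).
  set r := Num.sqrt _ in sq sq0 *.
  split; [|by rewrite lexx| |by rewrite lexx ler01|].
  - rewrite sq0/= -(@ler_pXn2r _ 2) ?nnegrE ?sq0 ?(ltW l0)// sq; nra.
  - by rewrite add0r -(@ler_pXn2r _ 2) ?nnegrE ?sq0 ?ler01// sq expr1n.
  - rewrite sq mulr0 addr0 mul0r addr0; lra.
have l1 : 1 < l by nra.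
have dl : 0 < 2 * (l - 1) by lra.
split; [by rewrite ler01 ltW|by rewrite lexx|lra| |].
  by rewrite divr_ge0 ?(ltW dl)//= ?ler_pdivrMr//; nra.
field; lra.
Qed.

Lemma resample_parametersP l t : 0 < l -> 0 <= t <= 1 ->
  [/\ 0 <= width l t <= l, 0 <= base l t, base l t + width l t <= 1,
      0 <= atom l t <= 1 &
      width l t ^+ 2 / 2 + base l t * width l t +
      (l - width l t) * atom l t = l * t].
Proof.
move=> l0 t01; have [w0 b0 bw p0 m] := low_parametersP l0 (fold_half_itv t01).
move: w0 b0 bw p0 m; rewrite /base /atom /width /fold_half; case: ifPn => // _.
set w := low_width _ _; set b := low_base _ _; set p := low_atom _ _.
by move=> /andP[w0 wl] b0 bw /andP[p0 p1] m; split;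
  [by rewrite w0|lra|lra|apply/andP; split; lra|nra].
Qed.

(** Any value in [0, 1] would do for a first argument outside [0, 1]: it is only
    evaluated at values of a regression function. *)
Definition resample l (q : R * R) : R :=
  if (0 <= q.1 <= 1) then sampler l (width l q.1) (base l q.1) (atom l q.1) q.2 else 0.

Lemma measurable_fold_half : measurable_fun setT fold_half.
Proof.
apply: measurable_fun_ifT => //; first exact: measurable_fun_ler.
exact: measurable_funB.
Qed.

Lemma measurable_low_width l : measurable_fun setT (low_width l).
Proof.
apply: measurable_fun_ifT => //.
  by apply: measurable_fun_ler => //; exact: measurable_funM.
apply: measurable_fun_ifT => //.
  by apply: measurable_fun_ler => //; exact: measurable_funM.
apply: measurableT_comp; last exact: measurable_funM.
by apply: continuous_measurable_fun; exact: sqrt_continuous.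
Qed.

Lemma measurable_width l : measurable_fun setT (width l).
Proof. exact: measurableT_comp (measurable_low_width l) measurable_fold_half. Qed.

Lemma measurable_low_base l : measurable_fun setT (low_base l).
Proof.
apply: measurable_fun_ifT => //.
  by apply: measurable_fun_ler => //; exact: measurable_funM.
exact: measurable_funB.
Qed.

Lemma measurable_low_atom l : measurable_fun setT (low_atom l).
Proof.
apply: measurable_fun_ifT => //.
  by apply: measurable_fun_ler => //; exact: measurable_funM.
by apply: measurable_funM => //; apply: measurable_funB.
Qed.

Let measurable_1B : measurable_fun setT (fun t : R => 1 - t).
Proof. exact: measurable_funB. Qed.

Lemma measurable_base l : measurable_fun setT (base l).
Proof.
apply: measurable_fun_ifT; [exact: measurable_fun_ler|exact: measurable_low_base|].
apply: measurable_funB; last exact: measurable_width.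
apply: measurable_funB => //.
exact: measurableT_comp (measurable_low_base l) measurable_1B.
Qed.

Lemma measurable_atom l : measurable_fun setT (atom l).
Proof.
apply: measurable_fun_ifT; [exact: measurable_fun_ler|exact: measurable_low_atom|].
apply: measurable_funB => //.
exact: measurableT_comp (measurable_low_atom l) measurable_1B.
Qed.

Lemma measurable_resample l : measurable_fun setT (resample l).
Proof.
have m1 := @measurable_fst _ _ R R.
have m2 := @measurable_snd _ _ R R.
have mw := measurableT_comp (measurable_width l) m1.
have mb := measurableT_comp (measurable_base l) m1.
have mp := measurableT_comp (measurable_atom l) m1.
have ml : measurable_fun setT (fun q : R * R => l * q.2) by exact: measurable_funM.
apply: measurable_fun_ifT => //.
  by apply: measurable_and; exact: measurable_fun_ler.
apply: measurable_fun_ifT => //.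
  by apply: measurable_and; exact: measurable_fun_ler.
exact: measurable_funD.
Qed.

Lemma resample01 l t u : 0 < l -> 0 <= t <= 1 -> 0 <= resample l (t, u) <= 1.
Proof.
move=> l0 t01; have [/andP[w0 wl] b0 bw p01 m] := resample_parametersP l0 t01.
rewrite /resample/= t01; exact: sampler01.
Qed.

Lemma resample_mean l t : 0 < l -> 0 <= t <= 1 ->
  (\int[unif R]_u (resample l (t, u))%:E = t%:E)%E.
Proof.
move=> l0 t01; have [/andP[w0 wl] b0 bw p01 m] := resample_parametersP l0 t01.
rewrite /resample/= t01; exact: sampler_mean.
Qed.

Lemma resample_trade_off l t (c : R -> \bar R) : 0 < l -> 0 <= t <= 1 ->
  measurable_fun setT c -> (forall z, (0 <= c z <= 1)%E) ->
  (l%:E * \int[unif R]_u c (resample l (t, u)) + (width l t)%:E <=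
   \int[unif R]_z c z + l%:E)%E.
Proof.
move=> l0 t01; have [/andP[w0 wl] b0 bw p01 m] := resample_parametersP l0 t01.
rewrite /resample/= t01; exact: sampler_trade_off.
Qed.

End optimal_kernel.

(** Integrated form of a pointwise trade-off; the terms are kept on the side
    where they are added, so that nothing is assumed to be finite. *)
Lemma le_integral_combination d (T : measurableType d) (R : realType)
    (P : probability T R) (l : R) (f g h : T -> \bar R) : (0 <= l)%R ->
  measurable_fun setT f -> measurable_fun setT g -> measurable_fun setT h ->
  (forall z, 0 <= f z) -> (forall z, 0 <= g z) -> (forall z, 0 <= h z) ->
  (forall z, l%:E * f z + h z <= g z + l%:E) ->
  l%:E * \int[P]_z f z + \int[P]_z h z <= \int[P]_z g z + l%:E.
Proof.
move=> l0 mf mg mh f0 g0 h0 fgh.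
rewrite -ge0_integralZl// -ge0_integralD//; last 2 first.
- by move=> z _; rewrite mule_ge0.
- exact: measurable_funeM.
rewrite -[X in _ + X](_ : \int[P]_z cst l%:E z = _); last first.
  by rewrite integral_cst//= probability_setT mule1.
rewrite -ge0_integralD//.
apply: ge0_le_integral => //.
- by move=> z _; rewrite adde_ge0// mule_ge0.
- by apply: emeasurable_funD => //; exact: measurable_funeM.
- exact: emeasurable_funD.
Qed.

Section length_bound.
Context (R : realType) (n d : nat) (dXi : measure_display) (Xi : measurableType dXi).
Local Notation U := (unif R).
Local Notation X := (d.-tuple R).
Local Notation T := (example R d).
Variables (nu : probability Xi R) (alpha : R) (C : algorithm R d n Xi).
Hypothesis mC : measurable_algorithm C.
Hypothesis hC : distribution_free_CI nu alpha C.
Variables (P : probability T R) (eta : {mfun X >-> R}).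
Hypothesis naP : nonatomic P.
Hypothesis etaP : is_regression_function P eta.

Local Notation cov := (coverage nu C P).

Lemma measurable_coverage : measurable_fun setT (fun q : X * R => cov q.1 q.2).
Proof.
apply: (measurable_fun_fubini_tonelli_F (fun q : (X * R) * Xi =>
  \int[iid_law P n]_D covers C (((D, q.2), q.1.1), q.1.2))); last first.
  by move=> q; apply: integral_ge0 => D _; exact: covers_ge0.
apply: (measurable_fun_fubini_tonelli_F (fun q : ((X * R) * Xi) * n.-tuple T =>
  covers C (((q.2, q.1.2), q.1.1.1), q.1.1.2))); last first.
  by move=> q; exact: covers_ge0.
apply: (measurableT_comp (measurable_covers mC)).
have m1 := @measurable_fst _ _ ((X * R) * Xi)%type (n.-tuple T).
have m2 := measurableT_comp (@measurable_fst _ _ (X * R)%type Xi) m1.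
apply: measurable_fun_pair.
  apply: measurable_fun_pair; last exact: (measurableT_comp (@measurable_fst _ _ X R) m2).
  apply: measurable_fun_pair => //.
  exact: (measurableT_comp (@measurable_snd _ _ (X * R)%type Xi) m1).
exact: (measurableT_comp (@measurable_snd _ _ X R) m2).
Qed.

Lemma coverage_ge0 x t : 0 <= cov x t.
Proof. by apply: integral_ge0 => xi _; apply: integral_ge0 => D _; exact: covers_ge0. Qed.

Lemma coverage_le1 x t : cov x t <= 1.
Proof.
have mk : measurable_fun setT (fun q : Xi * n.-tuple T => covers C (((q.2, q.1), x), t)).
  apply: (measurableT_comp (measurable_covers mC)
    (g := fun q : Xi * n.-tuple T => (((q.2, q.1), x), t))).
  by do 2 apply: measurable_fun_pair => //; apply: measurable_fun_pair.
rewrite -[leRHS](_ : \int[nu]_xi cst 1 xi = 1); last first.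
  by rewrite integral_cst//= mul1e probability_setT.
apply: ge0_le_integral => //.
- by move=> xi _; apply: integral_ge0 => D _; exact: covers_ge0.
- by apply: (measurable_fun_fubini_tonelli_F _ mk) => q; exact: covers_ge0.
move=> xi _.
rewrite -[leRHS](_ : \int[iid_law P n]_D cst 1 D = 1); last first.
  by rewrite integral_cst//= mul1e probability_setT.
apply: ge0_le_integral => //.
- by move=> D _; exact: covers_ge0.
- exact: (measurable_fun_slice (f := fun q : Xi * n.-tuple T => covers C (((q.2, q.1), x), t))).
- by move=> D _; exact: covers_le1.
Qed.

Lemma measurable_region D xi x : measurable (C D xi x).
Proof.
have := measurable_xsection (((D, xi), x) : (n.-tuple T * Xi) * X) mC.
by congr measurable; apply/seteqP; split => t; rewrite /xsection/= inE.
Qed.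

(** Only the part of the interval inside [0, 1] is needed for the lower bound. *)
Lemma covers_length D xi x :
  \int[U]_u covers C (((D, xi), x), u) <= lebesgue_measure (C D xi x).
Proof.
have mR := measurable_region D xi x.
rewrite integral_unif; last 2 first.
- apply: (measurable_fun_slice (f := covers C)); exact: measurable_covers.
- by move=> u; exact: covers_ge0.
apply: (@le_trans _ _ (\int[lebesgue_measure]_(u in `[0%R, 1%R]) (\1_(C D xi x) u)%:E)).
  rewrite le_eqVlt; apply/orP; left; apply/eqP; apply: eq_integral => u _.
  by rewrite /covers !indicE; congr ((nat_of_bool _)%:R%:E).
by rewrite integral_indic//; apply: le_measure; rewrite ?inE//; exact: measurableI.
Qed.

Lemma expected_length_ge :
  \int[P]_z \int[U]_u cov z.1 u <= expected_length nu P C.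
Proof.
pose f (w : (n.-tuple T * Xi) * T) := \int[U]_u covers C ((w.1, w.2.1), u).
have m1 := @measurable_fst _ _ X bool.
have mc : measurable_fun setT (fun w : ((n.-tuple T * Xi) * T) * R =>
    covers C ((w.1.1, w.1.2.1), w.2)).
  apply: (measurableT_comp (measurable_covers mC)).
  have m2 := @measurable_fst _ _ ((n.-tuple T * Xi) * T)%type R.
  apply: measurable_fun_pair => //; apply: measurable_fun_pair.
    exact: (measurableT_comp (@measurable_fst _ _ (n.-tuple T * Xi)%type T) m2).
  exact: (measurableT_comp m1 (measurableT_comp (@measurable_snd _ _ (n.-tuple T * Xi)%type T) m2)).
have c0 w : 0 <= covers C w by exact: covers_ge0.
have mf : measurable_fun setT f.
  by apply: (measurable_fun_fubini_tonelli_F _ mc).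
have f0 w : 0 <= f w by exact: integral_ge0.
apply: (@le_trans _ _ (\int[experiment n nu P]_w f w)); last first.
  apply: ge0_le_integral => //.
  - pose A := [set w : ((n.-tuple T * Xi) * T) * R | C w.1.1.1 w.1.1.2 w.1.2.1 w.2].
    have mA : measurable A.
      rewrite (_ : A = (fun w => covers C ((w.1.1, w.1.2.1), w.2)) @^-1` [set 1]).
        by rewrite -[X in measurable X]setTI; apply: mc => //; exact: emeasurable_set1.
      apply/seteqP; split => w; rewrite /A /covers/= indicE.
        by move=> h; rewrite mem_set.
      by case: (boolP (_ \in _)) => [|_ [] /eqP]; rewrite ?inE// eq_sym oner_eq0.
    have := @measurable_fun_xsection _ _ ((n.-tuple T * Xi) * T)%type
      (measurableTypeR R) R lebesgue_measure A mA.
    congr measurable_fun; apply/funext => w /=; congr (_ _).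
    by apply/seteqP; split => t; rewrite /xsection/= inE.
  - by move=> w _; rewrite /f; case: w => [[D xi] z]/=; exact: covers_length.
rewrite /experiment integral_triple231//.
pose h (q : (Xi * T) * R) : \bar R := \int[iid_law P n]_D covers C (((D, q.1.1), q.1.2.1), q.2).
have mq : measurable_fun setT (fun q : ((Xi * T) * R) * n.-tuple T =>
    covers C (((q.2, q.1.1.1), q.1.1.2.1), q.1.2)).
  apply: (measurableT_comp mc (g := fun q : ((Xi * T) * R) * n.-tuple T =>
    (((q.2, q.1.1.1), q.1.1.2), q.1.2))).
  have k1 := @measurable_fst _ _ ((Xi * T) * R)%type (n.-tuple T).
  have k2 := measurableT_comp (@measurable_fst _ _ (Xi * T)%type R) k1.
  apply: measurable_fun_pair; last first.
    exact: (measurableT_comp (@measurable_snd _ _ (Xi * T)%type R) k1).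
  apply: measurable_fun_pair; last exact: (measurableT_comp (@measurable_snd _ _ Xi T) k2).
  apply: measurable_fun_pair => //.
  exact: (measurableT_comp (@measurable_fst _ _ Xi T) k2).
have mh : measurable_fun setT h by apply: (measurable_fun_fubini_tonelli_F _ mq).
have h0 q : 0 <= h q by exact: integral_ge0.
rewrite le_eqVlt; apply/orP; left; apply/eqP.
transitivity (\int[nu]_xi \int[P]_z \int[U]_u h ((xi, z), u)); last first.
  apply: eq_integral => xi _; apply: eq_integral => z _.
  rewrite /f/= (fubini_tonelli (fun q : n.-tuple T * R => covers C (((q.1, xi), z.1), q.2)))//.
  apply: (measurableT_comp mc (g := fun q : n.-tuple T * R => (((q.1, xi), z), q.2))).
  by apply: measurable_fun_pair => //; apply: measurable_fun_pair => //; apply: measurable_fun_pair.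
rewrite (fubini_tonelli (fun p : Xi * T => \int[U]_u h (p, u))); last 2 first.
- exact: (measurable_fun_fubini_tonelli_F _ mh).
- by move=> p; exact: integral_ge0.
apply: eq_integral => z _.
rewrite (fubini_tonelli (fun p : Xi * R => h ((p.1, z), p.2)))//.
apply: (measurableT_comp mh (g := fun p : Xi * R => ((p.1, z), p.2))).
by apply: measurable_fun_pair => //; apply: measurable_fun_pair.
Qed.

(** The trade-off for the optimal law, integrated over the features and combined
    with the coverage of randomized values. *)
Lemma width_bound (l : R) : (0 < l)%R ->
  \int[regression_law P eta]_(t in @unit_interval R) (width l t)%:E <=
  expected_length nu P C + (l * alpha)%:E.
Proof.
move=> l0.
have cvg := coverage_randomized_value mC etaP (measurable_resample l)
  (fun t u => @resample01 _ l t u l0) (fun t => @resample_mean _ l t l0) naP hC.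
have mw := measurable_width l.
have eta01 := etaP.1.
have w0 t : (0 <= t <= 1)%R -> (0 <= width l t)%R.
  by move=> t01; have [/andP[]] := resample_parametersP l0 t01.
have mwz : measurable_fun setT (fun z : T => (width l (eta z.1))%:E).
  apply/measurable_EFinP; apply: (measurableT_comp mw).
  exact: (measurableT_comp (measurable_funP eta) measurable_fst).
have -> : \int[regression_law P eta]_(t in @unit_interval R) (width l t)%:E =
    \int[P]_z (width l (eta z.1))%:E.
  have mu : measurable (@unit_interval R) by exact: measurable_itv.
  rewrite /regression_law /distribution ge0_integral_pushforward//.
  - rewrite (_ : _ @^-1` _ = setT)//; apply/seteqP; split => // z _.
    by rewrite /= /feature_fun /unit_interval/= in_itv/=; exact: eta01.
  - by apply/measurable_EFinP; exact: measurable_funTS.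
  - by move=> t; rewrite inE /unit_interval/= in_itv/= lee_fin => /w0.
have mcu : measurable_fun setT (fun q : T * R => cov q.1.1 q.2).
  apply: (measurableT_comp measurable_coverage (g := fun q : T * R => (q.1.1, q.2))).
  apply: measurable_fun_pair => //.
  exact: (measurableT_comp (@measurable_fst _ _ X bool) measurable_fst).
have mcF : measurable_fun setT (fun q : T * R => cov q.1.1 (resample l (eta q.1.1, q.2))).
  apply: (measurableT_comp measurable_coverage (g := fun q : T * R =>
    (q.1.1, resample l (eta q.1.1, q.2)))).
  have m1 := measurableT_comp (@measurable_fst _ _ X bool) (@measurable_fst _ _ T R).
  apply: measurable_fun_pair => //.
  apply: (measurableT_comp (measurable_resample l)); apply: measurable_fun_pair => //.
  exact: (measurableT_comp (measurable_funP eta) m1).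
have c0 x t : 0 <= cov x t by exact: coverage_ge0.
have mI1 : measurable_fun setT (fun z : T => \int[U]_u cov z.1 (resample l (eta z.1, u))).
  exact: (measurable_fun_fubini_tonelli_F _ mcF).
have mI2 : measurable_fun setT (fun z : T => \int[U]_u cov z.1 u).
  exact: (measurable_fun_fubini_tonelli_F _ mcu).
have I10 (z : T) : 0 <= \int[U]_u cov z.1 (resample l (eta z.1, u)) by exact: integral_ge0.
have I20 (z : T) : 0 <= \int[U]_u cov z.1 u by exact: integral_ge0.
have main : (l * (1 - alpha))%:E + \int[P]_z (width l (eta z.1))%:E <=
    expected_length nu P C + l%:E.
  apply: (@le_trans _ _ (l%:E * \int[P]_z \int[U]_u cov z.1 (resample l (eta z.1, u)) +
      \int[P]_z (width l (eta z.1))%:E)).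
    by rewrite leeD2r// EFinM; apply: lee_wpmul2l; [rewrite lee_fin ltW|exact: cvg].
  apply: (@le_trans _ _ (\int[P]_z \int[U]_u cov z.1 u + l%:E)).
    apply: (le_integral_combination P (ltW l0) mI1 mI2 mwz I10 I20) => z.
      by rewrite lee_fin w0.
    apply: resample_trade_off; [exact: l0|exact: eta01| |].
      exact: (measurable_fun_slice (f := fun q : X * R => cov q.1 q.2) _ measurable_coverage).
    by move=> t; rewrite c0 coverage_le1.
  by rewrite leeD2r//; exact: expected_length_ge.
(* the missed coverage accounts for l - l * (1 - alpha) = l * alpha *)
rewrite -(@leeD2lE _ (l * (1 - alpha))%:E)//.
apply: (le_trans main).
by rewrite addeCA -EFinD mulrBr mulr1 subrK.
Qed.

End length_bound.

(** * Convex duality for the loss *)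

Section duality.
Context (R : realType).
Implicit Types (l s t a b x y : R).
Local Open Scope ring_scope.

(** The minimizer over a of [ell_half s a + l * a]. The convex function
    [ell_half s] has slopes between - 1 / (2 * s) and - 2 * s; the three regimes
    are those of l below, between and above the absolute values of these two. *)
Definition low_weight l s : R :=
  if l <= 2 * s then 1 else if 2 * l * s <= 1 then Num.sqrt (s / (2 * l)) else 0.
Definition weight l t : R := low_weight l (fold_half t).

Lemma ell_fold t a : ell t a = ell_half (fold_half t) a.
Proof. by rewrite /ell /fold_half; case: ifP. Qed.

Lemma ell_half_ge0 s a : 0 <= s <= 1 / 2 -> 0 <= a <= 1 -> 0 <= ell_half s a.
Proof.
move=> /andP[s0 s1] /andP[a0 a1]; rewrite /ell_half.
case: (leP (1 / 2) a) => a2; first by nra.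
case: (leP s a) => sa /=.
  by case: (ltP 0 a) => // a3; rewrite divr_ge0// mulr_ge0.
by rewrite subr_ge0 ler_pdivrMr; nra.
Qed.

(** For 0 < s the tangent to [ell_half s] at the point 1 / x, as a function of
    b. The parametrization by the inverse of the contact point makes it
    polynomial in x. *)
Definition tangent s x b : R := s * (x - b * x ^+ 2 / 2).

(** In x the tangent value is a concave quadratic with maximum at x = 1 / b;
    within the range [2, 1 / s] the best x is 1 / b truncated to that range, and
    the difference to the best value factors. *)
Lemma tangent_le_ell s x b : 0 < s <= 1 / 2 -> 0 <= b <= 1 -> 2 <= x <= s^-1 ->
  tangent s x b <= ell_half s b.
Proof.
move=> /andP[s0 s1] /andP[b0 b1] /andP[x2 xs]; rewrite /tangent /ell_half.
have xs1 : s * x <= 1 by rewrite mulrC -ler_pdivlMr// div1r.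
case: (leP (1 / 2) b) => b2.
  rewrite [leRHS](_ : _ = s * (2 * (1 - b))); last by ring.
  have h : 0 <= (x - 2) * (b * (x + 2) / 2 - 1) by apply: mulr_ge0; nra.
  by rewrite ler_pM2l//; lra.
case: (leP s b) => sb /=.
  have b3 : 0 < b by lra.
  rewrite b3 ler_pdivlMr; last by lra.
  rewrite -subr_ge0 (_ : _ - _ = s * (1 - b * x) ^+ 2); last by field.
  by rewrite mulr_ge0 ?sqr_ge0// ltW.
have ss : s * s^-1 = 1 by rewrite divff// gt_eqF.
rewrite (_ : b / (2 * s) = b * s^-1 / 2); last by rewrite invfM; ring.
set r := s^-1 in xs ss *.
have h : 0 <= (r - x) * (1 - b * (x + r) / 2) by apply: mulr_ge0; nra.
have -> : 1 - b * r / 2 = s * (r - b * r ^+ 2 / 2).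
  by transitivity (s * r - (s * r) * (b * r / 2)); [rewrite ss mul1r|field].
by rewrite ler_pM2l//; lra.
Qed.

Lemma ell_half_tangent s b : 0 < s <= 1 / 2 -> 0 <= b <= 1 ->
  exists2 x, 2 <= x <= s^-1 & ell_half s b = tangent s x b.
Proof.
move=> /andP[s0 s1] /andP[b0 b1]; rewrite /tangent /ell_half.
have sV2 : 2 <= s^-1 by rewrite -[2]invrK lef_pV2 ?posrE ?invr_gt0//; lra.
case: (leP (1 / 2) b) => b2.
  by exists 2; [rewrite lexx sV2|field].
case: (leP s b) => sb /=.
  have b3 : 0 < b by lra.
  rewrite b3; exists b^-1; last by field; rewrite gt_eqF.
  apply/andP; split; last by rewrite lef_pV2 ?posrE.
  by rewrite -[2]invrK lef_pV2 ?posrE ?invr_gt0//; lra.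
by exists s^-1; [rewrite lexx sV2|field; rewrite gt_eqF].
Qed.

Lemma ell_half0 b : 0 <= b -> ell_half 0 b = 0.
Proof.
move=> b0; rewrite /ell_half; case: ifP => _; first by rewrite mulr0.
by case: ifP => _; [rewrite mul0r|rewrite ltNge b0].
Qed.

(** For positive s the loss is the upper envelope of its tangents
    ([ell_half_tangent], [tangent_le_ell]); the tangent through the mixture lies
    below the loss at both ends. *)
Lemma ell_convex t a b (m : R) : 0 <= t <= 1 -> 0 <= a <= 1 -> 0 <= b <= 1 ->
  0 <= m <= 1 ->
  ell t (m * a + (1 - m) * b) <= m * ell t a + (1 - m) * ell t b.
Proof.
move=> t01 a01 b01 m01; rewrite !ell_fold.
have /andP[] := fold_half_itv t01; set s := fold_half t.
move: a01 b01 m01 => /andP[a0 a1] /andP[b0 b1] /andP[m0 m1].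
have c01 : 0 <= m * a + (1 - m) * b <= 1 by apply/andP; split; nra.
rewrite le_eqVlt => /predU1P[<- _|s0 s1].
  by rewrite !ell_half0// ?mulr0 ?addr0//; case/andP: c01.
have s01 : 0 < s <= 1 / 2 by rewrite s0.
have [x x01 ->] := ell_half_tangent s01 c01.
have ha : tangent s x a <= ell_half s a by apply: tangent_le_ell => //; rewrite a0.
have hb : tangent s x b <= ell_half s b by apply: tangent_le_ell => //; rewrite b0.
rewrite (_ : tangent s x _ = m * tangent s x a + (1 - m) * tangent s x b); last first.
  by rewrite /tangent; field.
by apply: lerD; apply: ler_wpM2l => //; rewrite subr_ge0.
Qed.

(** Besides the value of the Lagrangian at the minimizer, the bound l * a <= 1
    is what later guarantees that large multipliers respect any positive budget. *)
Lemma low_weightP l s : 0 <= l -> 0 <= s <= 1 / 2 ->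
  [/\ 0 <= low_weight l s <= 1, l * low_weight l s <= 1 &
      ell_half s (low_weight l s) + l * low_weight l s = low_width l s].
Proof.
move=> l0 /andP[s0 s1]; rewrite /low_weight /low_width.
case: (leP l (2 * s)) => ls.
  split; [by rewrite ler01 lexx|lra|].
  have h : 1 / 2 <= 1 :> R by lra.
  by rewrite /ell_half h; ring.
have {}l0 : 0 < l by lra.
case: (leP (2 * l * s) 1) => ls1.
  have sl0 : 0 <= s / (2 * l) by rewrite divr_ge0//; lra.
  have := sqr_sqrtr sl0; have := sqrtr_ge0 (s / (2 * l)).
  set r := Num.sqrt _ => r0 rE.
  have rE' : r ^+ 2 * (2 * l) = s by rewrite rE divfK// gt_eqF//; lra.
  have r2 : r < 1 / 2 by rewrite -(@ltr_pXn2r _ 2) ?nnegrE ?divr_ge0//; nra.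
  have -> : Num.sqrt (2 * l * s) = 2 * l * r.
    rewrite (_ : 2 * l * s = (2 * l * r) ^+ 2); last by rewrite -rE'; ring.
    by rewrite sqrtr_sqr ger0_norm//; nra.
  split; [by apply/andP; split; lra| |].
    rewrite -(@ler_pXn2r _ 2) ?nnegrE ?ler01 ?mulr_ge0 ?(ltW l0)//.
    rewrite exprMn expr1n; nra.
  rewrite /ell_half ifF; last by apply/negbTE; rewrite -ltNge.
  have [r1|r1] := ltP 0 r; last first.
    have r00 : r = 0 by apply/eqP; rewrite eq_le r1 r0.
    have s00 : s = 0 by rewrite -rE' r00; ring.
    by rewrite s00 r00 andbF ltxx; ring.
  have sr : s <= r by rewrite -(@ler_pXn2r _ 2) ?nnegrE//; nra.
  by rewrite sr/= -{1}rE'; field; rewrite gt_eqF.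
split; [by rewrite lexx ler01|by rewrite mulr0|].
have s00 : 0 < s by nra.
rewrite /ell_half ifF; last by apply/negbTE; rewrite -ltNge; lra.
rewrite ifF; last by rewrite ltxx andbF.
by rewrite s00 mul0r subr0 mulr0 addr0.
Qed.

Lemma weightP l t : 0 <= l -> 0 <= t <= 1 ->
  [/\ 0 <= weight l t <= 1, l * weight l t <= 1 &
      ell t (weight l t) + l * weight l t = width l t].
Proof.
by move=> l0 t01; rewrite ell_fold; exact: low_weightP (fold_half_itv t01).
Qed.

Lemma measurable_low_weight l : measurable_fun setT (low_weight l).
Proof.
apply: measurable_fun_ifT => //.
  by apply: measurable_fun_ler => //; exact: measurable_funM.
apply: measurable_fun_ifT => //.
  by apply: measurable_fun_ler => //; exact: measurable_funM.
apply: measurableT_comp; last exact: measurable_funM.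
by apply: continuous_measurable_fun; exact: sqrt_continuous.
Qed.

Lemma measurable_weight l : measurable_fun setT (weight l).
Proof.
exact: measurableT_comp (measurable_low_weight l) (@measurable_fold_half R).
Qed.

Lemma width0 t : 0 <= t <= 1 -> width 0 t = 0.
Proof.
move=> /fold_half_itv/andP[s0 _].
by rewrite /width /low_width mulr_ge0.
Qed.

(** The integral of a nonnegative function is a supremum over the simple
    functions below it, so monotonicity holds without measurability. It applies
    to the loss along a function a without a study of its measurability. *)
Lemma ge0_le_integral_nonmeasurable d (T : measurableType d)
    (mu : {measure set T -> \bar R}) (D : set T) (f1 f2 : T -> \bar R) :
  (forall z, D z -> 0 <= f1 z)%E -> (forall z, D z -> f1 z <= f2 z)%E ->
  (\int[mu]_(x in D) f1 x <= \int[mu]_(x in D) f2 x)%E.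
Proof.
move=> f10 f12.
rewrite !ge0_integralE//; last by move=> z Dz; apply: le_trans (f10 z Dz) (f12 z Dz).
apply: le_ereal_sup => _ [h hf <-]; exists h => // z.
by apply: (le_trans (hf z)); apply: lee_restrict.
Qed.

Section dual_bound.
Variables (Q : probability R R) (alpha beta : R).
Hypothesis Q1 : Q (@unit_interval R) = 1%E.
Hypothesis alpha01 : 0 <= alpha <= 1.
Hypothesis beta0 : 0 <= beta.
Hypothesis bound : forall l, 0 < l ->
  (\int[Q]_(t in @unit_interval R) (width l t)%:E <= beta%:E + (l * alpha)%:E)%E.

Let mU : measurable (@unit_interval R). Proof. exact: measurable_itv. Qed.

Let unitP t : (@unit_interval R) t -> 0 <= t <= 1.
Proof. by rewrite /unit_interval/= in_itv. Qed.

Lemma L_le_integral (a : R -> R) : measurable_fun setT a ->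
  (forall t, 0 <= t <= 1 -> 0 <= a t <= 1) ->
  (\int[Q]_(t in @unit_interval R) (a t)%:E <= alpha%:E)%E ->
  (L alpha Q <= \int[Q]_(t in @unit_interval R) (ell t (a t))%:E)%E.
Proof.
move=> ma a01 aalpha; apply: ereal_inf_lbound; exists a => //; split => //.
exact: measurable_funTS.
Qed.

Lemma integral_unit_fin (f : R -> R) : measurable_fun setT f ->
  (forall t, 0 <= t <= 1 -> 0 <= f t <= 1) ->
  exists2 r : R, 0 <= r <= 1 & (\int[Q]_(t in @unit_interval R) (f t)%:E = r%:E)%E.
Proof.
move=> mf f01.
have If0 : (0 <= \int[Q]_(t in @unit_interval R) (f t)%:E)%E.
  by apply: integral_ge0 => t /unitP/f01/andP[? _]; rewrite lee_fin.
have If1 : (\int[Q]_(t in @unit_interval R) (f t)%:E <= 1)%E.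
  rewrite -[leRHS](_ : (\int[Q]_(t in @unit_interval R) cst 1 t = 1)%E); last first.
    by rewrite integral_cst// mul1e.
  apply: ge0_le_integral_nonmeasurable => t /unitP/f01/andP[? ?]; by rewrite lee_fin.
exists (fine (\int[Q]_(t in @unit_interval R) (f t)%:E)%E).
  rewrite fine_ge0//= -lee_fin fineK//.
  by rewrite ge0_fin_numE// (le_lt_trans If1)// ltry.
by rewrite fineK// ge0_fin_numE// (le_lt_trans If1)// ltry.
Qed.

(** A is the budget spent by the weight for l and E its cost; the dual bound for
    l reads E <= beta + l * (alpha - A). *)
Lemma weight_integrals l : 0 <= l ->
  exists A E : R,
  [/\ 0 <= A <= 1, l * A <= 1, E + l * A <= beta + l * alpha,
      (\int[Q]_(t in @unit_interval R) (weight l t)%:E = A%:E)%E &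
      (\int[Q]_(t in @unit_interval R) (width l t - l * weight l t)%:E = E%:E)%E].
Proof.
move=> l0.
have mwt := measurable_weight l.
have mwd := @measurable_width R l.
have w01 t : 0 <= t <= 1 -> 0 <= weight l t <= 1 by move=> /(weightP l0)[].
have md : measurable_fun setT (fun t => width l t - l * weight l t).
  by apply: measurable_funB => //; exact: measurable_funM.
have [A A01 AE] := integral_unit_fin mwt w01.
have dE t : 0 <= t <= 1 -> width l t - l * weight l t = ell t (weight l t).
  by move=> /(weightP l0)[_ _ <-]; rewrite addrK.
have e0 t : 0 <= t <= 1 -> 0 <= ell t (weight l t).
  move=> t01; rewrite ell_fold; apply: ell_half_ge0; [exact: fold_half_itv|exact: w01].
have wd1 t : 0 <= t <= 1 -> 0 <= width l t <= 1.
  move: l0; rewrite le_eqVlt => /predU1P[<-|l0] t01; first by rewrite width0// lexx ler01.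
  by have [/andP[w0 _] b0 bw _ _] := resample_parametersP l0 t01; rewrite w0/=; lra.
have d01 t : 0 <= t <= 1 -> 0 <= width l t - l * weight l t <= 1.
  move=> t01; rewrite {1}dE// e0//=; have /andP[_ h1] := wd1 t t01.
  have /andP[h2 _] := w01 t t01.
  by have := mulr_ge0 l0 h2; lra.
have [E E01 EE] := integral_unit_fin md d01.
have lw01 t : 0 <= t <= 1 -> 0 <= l * weight l t <= 1.
  by move=> t01; have [/andP[h0 _] -> _] := weightP l0 t01; rewrite mulr_ge0.
have mlw : measurable_fun setT (fun t => l * weight l t) by exact: measurable_funM.
have [lA lA01 lAE] := integral_unit_fin mlw lw01.
have lAA : lA = l * A.
  apply: EFin_inj; rewrite -lAE EFinM -AE -ge0_integralZl_EFin//.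
  - by move=> t /unitP/w01/andP[? _]; rewrite lee_fin.
  - by apply/measurable_EFinP; exact: measurable_funTS.
exists A, E; split => //; first by rewrite -lAA; case/andP: lA01.
have sumE : (\int[Q]_(t in @unit_interval R) (width l t)%:E = (E + l * A)%:E)%E.
  rewrite EFinD -EE -lAA -lAE -ge0_integralD//.
  - by apply: eq_integral => t _; rewrite -EFinD subrK.
  - by move=> t /unitP/d01/andP[? _]; rewrite lee_fin.
  - by apply/measurable_EFinP; exact: measurable_funTS.
  - by move=> t /unitP/lw01/andP[? _]; rewrite lee_fin.
  - by apply/measurable_EFinP; exact: measurable_funTS.
move: l0; rewrite le_eqVlt => /predU1P[l00|l0].
  rewrite -lee_fin -sumE -l00 mul0r addr0 integral0_eq// => t /unitP t01.
  by rewrite width0.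
by rewrite -lee_fin -sumE EFinD; exact: bound.
Qed.

Lemma weight_values l t : 0 <= l -> 0 <= t <= 1 ->
  [/\ 0 <= weight l t <= 1, 0 <= width l t - l * weight l t &
      ell t (weight l t) = width l t - l * weight l t].
Proof.
move=> l0 t01; have [w01 _ wE] := weightP l0 t01.
have e0 : 0 <= ell t (weight l t).
  by rewrite ell_fold; apply: ell_half_ge0 => //; exact: fold_half_itv.
by rewrite -wE addrK.
Qed.

(** By convexity of the loss the cost of a mixture of two weights is at most the
    mixture of their costs. *)
Lemma L_le_mixture l1 l2 m A1 A2 E1 E2 :
  0 <= l1 -> 0 <= l2 -> 0 <= m <= 1 -> m * A1 + (1 - m) * A2 <= alpha ->
  (\int[Q]_(t in @unit_interval R) (weight l1 t)%:E = A1%:E)%E ->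
  (\int[Q]_(t in @unit_interval R) (weight l2 t)%:E = A2%:E)%E ->
  (\int[Q]_(t in @unit_interval R) (width l1 t - l1 * weight l1 t)%:E = E1%:E)%E ->
  (\int[Q]_(t in @unit_interval R) (width l2 t - l2 * weight l2 t)%:E = E2%:E)%E ->
  (L alpha Q <= (m * E1 + (1 - m) * E2)%:E)%E.
Proof.
move=> l10 l20 m01 mA A1E A2E E1E E2E.
have [m0 m1] : 0 <= m /\ 0 <= 1 - m by case/andP: m01; split; lra.
have mw l := measurable_weight l.
have mwd l := @measurable_width R l.
have md l : measurable_fun setT (fun t => width l t - l * weight l t).
  by apply: measurable_funB => //; exact: measurable_funM.
have comb (f g : R -> R) (x y : R) : measurable_fun setT f -> measurable_fun setT g ->
    (forall t, 0 <= t <= 1 -> 0 <= f t) -> (forall t, 0 <= t <= 1 -> 0 <= g t) ->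
    (\int[Q]_(t in @unit_interval R) (f t)%:E = x%:E)%E ->
    (\int[Q]_(t in @unit_interval R) (g t)%:E = y%:E)%E ->
    (\int[Q]_(t in @unit_interval R) (m * f t + (1 - m) * g t)%:E =
      (m * x + (1 - m) * y)%:E)%E.
  move=> mf mg f0 g0 fE gE.
  have mf' : measurable_fun (@unit_interval R) (fun t => (f t)%:E).
    by apply/measurable_EFinP; exact: measurable_funTS.
  have mg' : measurable_fun (@unit_interval R) (fun t => (g t)%:E).
    by apply/measurable_EFinP; exact: measurable_funTS.
  have f0' t : (@unit_interval R) t -> (0 <= (f t)%:E)%E.
    by move=> /unitP/f0; rewrite lee_fin.
  have g0' t : (@unit_interval R) t -> (0 <= (g t)%:E)%E.
    by move=> /unitP/g0; rewrite lee_fin.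
  rewrite EFinD !EFinM -fE -gE -!ge0_integralZl_EFin// -ge0_integralD//.
  - by move=> t Ut; rewrite mule_ge0// f0'.
  - exact: measurable_funeM.
  - by move=> t Ut; rewrite mule_ge0// g0'.
  - exact: measurable_funeM.
apply: (le_trans (@L_le_integral (fun t => m * weight l1 t + (1 - m) * weight l2 t) _ _ _)).
- by apply: measurable_funD; exact: measurable_funM.
- move=> t t01; have [/andP[a0 a1] _ _] := weight_values l10 t01.
  have [/andP[b0 b1] _ _] := weight_values l20 t01.
  by apply/andP; split; nra.
- rewrite (comb _ _ _ _ _ _ _ _ A1E A2E)// ?lee_fin// => t t01.
  + by have [/andP[]] := weight_values l10 t01.
  + by have [/andP[]] := weight_values l20 t01.
rewrite -(comb _ _ _ _ _ _ _ _ E1E E2E)//; last 2 first.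
- by move=> t t01; have [] := weight_values l10 t01.
- by move=> t t01; have [] := weight_values l20 t01.
apply: ge0_le_integral_nonmeasurable => t /unitP t01; rewrite lee_fin;
  have [a01 _ aE] := weight_values l10 t01; have [b01 _ bE] := weight_values l20 t01.
  rewrite ell_fold; apply: ell_half_ge0; first exact: fold_half_itv.
  by case/andP: a01 => ? ?; case/andP: b01 => ? ?; apply/andP; split; nra.
by rewrite -aE -bE; exact: ell_convex.
Qed.

(** Multipliers run through the grid k * e. The first k whose weight respects
    the budget is mixed with the previous one so that the budget is met exactly.
    The two dual bounds then add up to beta plus an error at most e, the gap
    between the two multipliers. *)
Lemma L_le_bound_pos : 0 < alpha -> (L alpha Q <= beta%:E)%E.
Proof.
move=> a0; have /andP[_ a1] := alpha01.
apply/lee_addgt0Pr => e e0.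
have AE l : 0 <= l -> exists A E : R,
  [/\ 0 <= A <= 1, l * A <= 1, E + l * A <= beta + l * alpha,
      (\int[Q]_(t in @unit_interval R) (weight l t)%:E = A%:E)%E &
      (\int[Q]_(t in @unit_interval R) (width l t - l * weight l t)%:E = E%:E)%E].
  exact: weight_integrals.
pose feasible k := `[< (\int[Q]_(t in @unit_interval R) (weight (k%:R * e) t)%:E <= alpha%:E)%E >].
have exk : exists k, feasible k.
  (* since l * weight l t <= 1, any l above 1 / alpha is feasible *)
  pose k := (Num.trunc (alpha^-1 / e)).+1.
  exists k; apply/asboolP.
  have kb : alpha^-1 <= k%:R * e.
    by rewrite -ler_pdivrMr// ltW//; exact: truncnS_gt.
  have k0 : 0 <= k%:R * e by rewrite mulr_ge0// ltW.
  have [A [E [/andP[A0 _] lA _ -> _]]] := AE _ k0.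
  rewrite lee_fin -(@ler_pM2l _ alpha^-1) ?invr_gt0// mulVf ?gt_eqF//.
  by apply: le_trans lA; rewrite ler_wpM2r.
have [k /asboolP fk kmin] := ex_minnP exk.
have l20 : 0 <= k%:R * e by rewrite mulr_ge0// ltW.
have [A2 [E2 [/andP[A20 A21] lA2 EA2 A2E E2E]]] := AE _ l20.
have {}fk : A2 <= alpha by rewrite -lee_fin -A2E.
case: k => [|k] in fk kmin l20 lA2 EA2 A2E E2E *.
  (* l = 0 is feasible by itself *)
  apply: (le_trans (L_le_mixture (m := 1) l20 l20 _ _ A2E A2E E2E E2E)).
  - by rewrite ler01 lexx.
  - by rewrite subrr mul0r addr0 mul1r.
  - rewrite -EFinD lee_fin; move: EA2; rewrite !mul0r !addr0; lra.
have l10 : 0 <= k%:R * e by rewrite mulr_ge0// ltW.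
have [A1 [E1 [/andP[A10 A11] lA1 EA1 A1E E1E]]] := AE _ l10.
have nfk : alpha < A1.
  rewrite ltNge; apply/negP => h; have := kmin k.
  rewrite ltnn => /(_ _)/negP; apply; last by [].
  by apply/asboolP; rewrite A1E lee_fin.
have d0 : 0 < A1 - A2 by lra.
(* the proportion that makes the mixed budget equal to alpha *)
pose m := (alpha - A2) / (A1 - A2).
have mE : m * (A1 - A2) = alpha - A2 by rewrite divfK// gt_eqF.
have m0 : 0 <= m by rewrite divr_ge0; lra.
have m1 : m <= 1 by rewrite ler_pdivrMr//; lra.
apply: (le_trans (L_le_mixture (m := m) l10 l20 _ _ A1E A2E E1E E2E)).
- by rewrite m0 m1.
- lra.
rewrite -EFinD lee_fin.
have l2E : k.+1%:R * e = k%:R * e + e by rewrite -natr1 mulrDl mul1r.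
rewrite l2E in EA2.
set l1 := k%:R * e in EA1 EA2 l10.
have h1 : m * E1 <= m * (beta + l1 * (alpha - A1)) by rewrite ler_wpM2l//; lra.
have h2 : (1 - m) * E2 <= (1 - m) * (beta + (l1 + e) * (alpha - A2)).
  by rewrite ler_wpM2l//; lra.
have h3 : (1 - m) * (alpha - A2) <= 1 by nra.
have h4 : e * ((1 - m) * (alpha - A2)) <= e by rewrite -[leRHS]mulr1 ler_wpM2l// ltW.
have h5 : l1 * (alpha - m * A1 - (1 - m) * A2) = 0.
  by rewrite (_ : _ - _ - _ = 0) ?mulr0//; lra.
lra.
Qed.

(** The function zero respects every budget, and its cost is the probability
    that t differs from 0 and 1. For such t the width is 1 as soon as l exceeds
    1 / (2 * fold_half t), so that probability is the limit of quantities
    bounded by beta. *)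
Lemma L_le_bound_zero : alpha = 0 -> (L alpha Q <= beta%:E)%E.
Proof.
move=> a0.
apply: (le_trans (@L_le_integral (fun=> 0) _ _ _)) => //.
- by move=> t _; rewrite lexx ler01.
- by rewrite a0 integral0_eq.
pose A k : set R := [set t | 1 < 2 * k%:R * fold_half t].
have mA k : measurable (A k).
  rewrite (_ : A k = (fun t => 2 * k%:R * fold_half t) @^-1` `]1, +oo[%classic).
    rewrite -[X in measurable X]setTI.
    by apply: (measurable_funM (measurable_cst _) (@measurable_fold_half R)).
  by apply/seteqP; split => t; rewrite /A/= in_itv/= andbT.
have QA k : (Q (@unit_interval R `&` A k.+1) <= beta%:E)%E.
  have := @bound k.+1%:R (ltr0Sn _ _); rewrite a0 mulr0 adde0; apply: le_trans.
  rewrite setIC -integral_indic//; apply: ge0_le_integral_nonmeasurable => t Ut.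
    by rewrite lee_fin.
  rewrite lee_fin indicE.
  have t01 := unitP Ut; have /andP[s0 s1] := fold_half_itv t01.
  have [tA|tA] := boolP (t \in A _).
    move: tA; rewrite inE /A/= => tA.
    have k1 : 1 <= k.+1%:R :> R by rewrite ler1n.
    rewrite /width /low_width ifF; last by apply/negbTE; rewrite -ltNge; nra.
    by rewrite ifF//; apply/negbTE; rewrite -ltNge.
  by have [/andP[]] := resample_parametersP (ltr0Sn R k) t01.
have ndA : nondecreasing_seq (fun k => @unit_interval R `&` A k.+1).
  move=> m n mn; apply/subsetPset => t [Ut tA]; split => //.
  apply: (lt_le_trans tA); have /andP[s0 s1] := fold_half_itv (unitP Ut).
  by rewrite ler_wpM2r// ler_wpM2l// ler_nat ltnS.
have mUA k : measurable (@unit_interval R `&` A k.+1) by exact: measurableI.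
have cvgA := @nondecreasing_cvg_mu _ _ _ Q _ mUA (bigcupT_measurable _ mUA) ndA.
apply: (@le_trans _ _ (Q (\bigcup_k (@unit_interval R `&` A k.+1)))); last first.
  by apply: (cvge_to_le cvgA); apply: nearW => k; exact: QA.
have UAE : \bigcup_k (@unit_interval R `&` A k.+1) =
    \bigcup_k (@unit_interval R `&` A k.+1) `&` @unit_interval R.
  by apply/esym/setIidl => t [k _ []].
rewrite UAE -integral_indic//; last exact: bigcupT_measurable.
apply: ge0_le_integral_nonmeasurable => t Ut; rewrite lee_fin ell_fold;
  have /andP[s0 s1] := fold_half_itv (unitP Ut).
  by apply: ell_half_ge0; rewrite ?s0 ?lexx ?ler01.
move: s0; rewrite le_eqVlt => /predU1P[<-|s0]; first by rewrite ell_half0// indicE.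
rewrite indicE mem_set.
  rewrite /ell_half ifF; last by apply/negbTE; rewrite -ltNge; lra.
  by rewrite ltxx andbF s0 mul0r subr0.
exists (Num.trunc ((2 * fold_half t)^-1)) => //; split => //.
have h2 : 0 < 2 * fold_half t by lra.
have : (2 * fold_half t)^-1 < (Num.trunc ((2 * fold_half t)^-1)).+1%:R by exact: truncnS_gt.
by rewrite -(ltr_pM2r h2) mulVf ?gt_eqF// /A/= mulrA [_ * 2]mulrC.
Qed.

Lemma L_le_bound : (L alpha Q <= beta%:E)%E.
Proof.
have /andP[] := alpha01; rewrite le_eqVlt => /predU1P[/esym|] h _.
  exact: L_le_bound_zero.
exact: L_le_bound_pos.
Qed.
End dual_bound.
End duality.

Local Open Scope ring_scope.

Theorem theorem2 (R : realType) (n d : nat) (hn : (0 < n)%N) (hd : (0 < d)%N)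
    (alpha : R) (halpha : 0 <= alpha <= 1)
    (dXi : measure_display) (Xi : measurableType dXi) (nu : probability Xi R)
    (C : algorithm R d n Xi) (mC : measurable_algorithm C)
    (hC : distribution_free_CI nu alpha C)
    (P : probability (example R d) R) (hP : nonatomic P)
    (eta : {mfun d.-tuple R >-> R}) (heta : is_regression_function P eta) :
  (L alpha (regression_law P eta) <= expected_length nu P C)%E.
Proof.
have Bge0 : (0 <= expected_length nu P C)%E by exact: integral_ge0.
have bound l := width_bound mC hC hP heta (l := l).
case: (expected_length nu P C) Bge0 bound => [b|_ _|//]; last by rewrite leey.
rewrite lee_fin => b0 bound; apply: L_le_bound => //.
transitivity (P setT); last exact: probability_setT.
congr (P _); apply/seteqP; split => // z _.
by rewrite /= /feature_fun /unit_interval/= in_itv/=; exact: heta.1.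
Qed.
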